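(* Assume $\mathbf x_j^T\mathbf x_j=1$ for all $j$. For every $\bar{\mathbf b}\in\mathbb R^p$, $g\in\mathcal{G}(\sigma_1^2,\dots,\sigma_K^2)$ and $\sigma^2>0$, $$h(\bar{\mathbf b},g,\sigma^2)=\frac1{2\sigma^2}\|\mathbf y-\mathbf X\bar{\mathbf b}\|^2+\frac1{\sigma^2}\sum_{j=1}^p\rho_{g_\sigma,\sigma}(\bar b_j)+\frac{n-p}2\log(2\pi\sigma^2).$$ Moreover, for $f=g_\sigma$ and every $y\in\mathbb R$, the penalty satisfies $\rho_{f,\sigma}(S_{f,\sigma}(y))=-\sigma^2\ell_{\mathrm{NM}}(y;f,\sigma^2)-\tfrac12(y-S_{f,\sigma}(y))^2$ and $\rho'_{f,\sigma}(S_{f,\sigma}(y))=y-S_{f,\sigma}(y)$.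
   Context: Data $\mathbf y\in\mathbb R^n$, $\mathbf X\in\mathbb R^{n\times p}$ with columns $\mathbf x_j$. Grid $0=\sigma_1^2<\dots<\sigma_K^2<\infty$, $N(0,0)=\delta_0$, $\mathcal{G}(\sigma_1^2,\dots,\sigma_K^2)=\{g=\sum_k\pi_kN(0,\sigma_k^2):\pi\in\mathbb S^K\}$; $g_\sigma$ denotes the distribution of $\sigma b$ when $b\sim g$, i.e. $g_\sigma=\sum_k\pi_kN(0,\sigma^2\sigma_k^2)$. Model: $\mathbf y\mid\mathbf X,\mathbf b,\sigma^2\sim N(\mathbf X\mathbf b,\sigma^2\mathbf I_n)$; $\gamma_j$ i.i.d. with $P(\gamma_j=k)=\pi_k$, $b_j\mid\gamma_j=k\sim N(0,\sigma^2\sigma_k^2)$. ELBO $F(q,g,\sigma^2)=\log p(\mathbf y\mid\mathbf X,g,\sigma^2)-D_{\mathrm{KL}}(q\,\|\,p(\mathbf b,\boldsymbol\gamma\mid\mathbf X,\mathbf y,g,\sigma^2))$; $\mathcal Q$ = fully factorized distributions $\prod_jq_j(b_j,\gamma_j)$; $h(\bar{\mathbf b},g,\sigma^2)=-\sup\{F(q,g,\sigma^2):q\in\mathcal Q,\mathbb E_q[\mathbf b]=\bar{\mathbf b}\}$. For a mixture prior $f=\sum_k\pi_kN(0,u_k^2)$ let $p_{\mathrm{prior}}(f)$ be the joint law of $(b,\gamma)$ with $P(\gamma=k)=\pi_k$, $b\mid\gamma=k\sim N(0,u_k^2)$. For $s>0$, the normal means model $\mathrm{NM}_1(f,s^2)$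 is $y\mid b\sim N(b,s^2)$, $b\sim f$; $\ell_{\mathrm{NM}}(y;f,s^2)=\log p(y\mid f,s^2)$ is its marginal log-likelihood and $S_{f,s}(y)=\mathbb E(b\mid y,f,s^2)$ its posterior mean. Penalty: $\rho_{f,s}(\bar b)=\inf_{q:\mathbb E_q(b)=\bar b}\big\{\tfrac{s^2}2\log(2\pi s^2)+\tfrac12\mathrm{Var}_q(b)+s^2D_{\mathrm{KL}}(q\,\|\,p_{\mathrm{prior}}(f))\big\}$, the infimum over distributions $q$ on $(b,\gamma)\in\mathbb R\times\{1,\dots,K\}$.
   Formalization: The derivative formula for the penalty is stated only when π_1 < 1, i.e. g is not the point mass at 0; for g = δ_0 the penalty is +∞ away from 0, so its derivative at S(y) = 0 does not exist. *)

(* Defs.v *)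
From HB Require Import structures.
From mathcomp Require Import all_boot all_order all_algebra.
From mathcomp Require Import all_classical all_reals all_analysis measurable_realfun.
Set Implicit Arguments. Unset Strict Implicit. Unset Printing Implicit Defensive.
Import Order.TTheory GRing.Theory Num.Theory.
Import numFieldNormedType.Exports.
Local Open Scope classical_set_scope.
Local Open Scope ring_scope.

(* All the probabilistic objects live on R x {0,..,K} (one coordinate) or on
   R^p x {0,..,K}^p (all coordinates).  A (finite) measure on R x 'I_K.+1
   (with the discrete sigma-algebra on the finite factor) is literally the
   family of its K.+1 slices  k |-> q(. x {k}), each a measure on R.
   Component index 0 plays the role of the paper's index 1 (sigma_1^2 = 0). *)

Section Defs.
Context {R : realType}.

(* N(0,u^2) with the paper's convention N(0,0) = delta_0; u is the std. dev. *)
Definition normal0 (u : R) : set R -> \bar R :=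
  if u == 0 then dirac (0 : R) else normal_prob 0 u.

(* p_prior(f) for f = sum_k pi_k N(0, u_k^2): its slice at gamma = k is
   the measure  A |-> pi_k * N(0,u_k^2)(A). *)
Definition prior_slice (K : nat) (w u : 'I_K.+1 -> R) (k : 'I_K.+1)
  : set R -> \bar R := fun A => ((w k)%:E * normal0 (u k) A)%E.

Definition is_dist (K : nat) (q : 'I_K.+1 -> {measure set R -> \bar R}) :=
  (\sum_(k < K.+1) q k setT = 1)%E.

Definition is_density (K : nat) (q P : 'I_K.+1 -> set R -> \bar R)
  (f : 'I_K.+1 -> R -> \bar R) : Prop :=
  forall k, measurable_fun [set: R] (f k) /\ (forall x, (0 <= f k x)%E) /\
    forall A, measurable A -> q k A = (\int[P k]_(x in A) f k x)%E.

Definition abs_cont (K : nat) (q P : 'I_K.+1 -> set R -> \bar R) : Prop :=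
  exists f, is_density q P f.

Definition dens (K : nat) (q P : 'I_K.+1 -> set R -> \bar R)
  : 'I_K.+1 -> R -> \bar R :=
  match pselect (abs_cont q P) with
  | left h => sval (cid h)
  | right _ => fun _ _ => 0%E
  end.

Definition KL (K : nat) (q P : 'I_K.+1 -> set R -> \bar R) : \bar R :=
  if pselect (abs_cont q P) then
    (\sum_(k < K.+1) \int[q k]_(x in setT) lne (dens q P k x))%E
  else +oo%E.

Definition dmean (K : nat) (q : 'I_K.+1 -> set R -> \bar R) : \bar R :=
  (\sum_(k < K.+1) \int[q k]_(x in setT) x%:E)%E.
Definition dvar (K : nat) (q : 'I_K.+1 -> set R -> \bar R) (m : R) : \bar R :=
  (\sum_(k < K.+1) \int[q k]_(x in setT) ((x - m) ^+ 2)%:E)%E.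

Definition rho (K : nat) (w u : 'I_K.+1 -> R) (s : R) (bbar : R) : \bar R :=
  ereal_inf [set v | exists q : 'I_K.+1 -> {measure set R -> \bar R},
    [/\ is_dist q,
        (forall k, (q k).-integrable setT (fun x => x%:E)),
        dmean (fun k => q k) = bbar%:E &
        v = ((s ^+ 2 / 2 * ln (2 * pi * s ^+ 2))%:E
             + (1 / 2)%:E * dvar (fun k => q k) bbar
             + (s ^+ 2)%:E * KL (fun k => q k) (prior_slice w u))%E]].

Definition nm_marginal (K : nat) (w u : 'I_K.+1 -> R) (s y : R) : \bar R :=
  (\sum_(k < K.+1)
     \int[prior_slice w u k]_(b in setT) (normal_pdf b s y)%:E)%E.
Definition ell_NM (K : nat) (w u : 'I_K.+1 -> R) (s y : R) : \bar R :=
  lne (nm_marginal w u s y).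
Definition S_NM (K : nat) (w u : 'I_K.+1 -> R) (s y : R) : R :=
  fine (\sum_(k < K.+1)
     \int[prior_slice w u k]_(b in setT) (b * normal_pdf b s y)%:E)%E
  / fine (nm_marginal w u s y).

Definition upd {T : Type} (b : nat -> T) (m : nat) (x : T) : nat -> T :=
  fun i => if i == m then x else b i.

(* iterated integral over coordinates 0..m-1 w.r.t. the product of the
   measures Q j on R x 'I_K.+1 (Fubini form of the product measure) *)
Fixpoint iint (K : nat) (Q : nat -> 'I_K.+1 -> set R -> \bar R)
  (phi : (nat -> R) -> (nat -> 'I_K.+1) -> \bar R) (m : nat)
  (b : nat -> R) (g : nat -> 'I_K.+1) : \bar R :=
  match m with
  | 0 => phi b g
  | m'.+1 => (\sum_(k < K.+1) \int[Q m' k]_(x in setT)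
                 iint Q phi m' (upd b m' x) (upd g m' k))%E
  end.

Definition prodE (p K : nat) (Q : nat -> 'I_K.+1 -> set R -> \bar R)
  (phi : (nat -> R) -> (nat -> 'I_K.+1) -> \bar R) : \bar R :=
  iint Q phi p (fun _ => 0) (fun _ => ord0).

(* log p(y | X, b, sigma^2) for y ~ N(X b, sigma^2 I_n) *)
Definition loglik (n p : nat) (y : 'cV[R]_n) (X : 'M[R]_(n, p)) (sigma2 : R)
  (b : nat -> R) : R :=
  - (n%:R / 2) * ln (2 * pi * sigma2)
  - (\sum_(i < n) ((y - X *m \col_(j < p) b j) i 0) ^+ 2) / (2 * sigma2).

Definition ext (p K : nat) (q : 'I_p -> 'I_K.+1 -> set R -> \bar R)
  : nat -> 'I_K.+1 -> set R -> \bar R :=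
  fun j k => match insub j with Some j' => q j' k | None => fun _ => 0%E end.

(* g = sum_k pi_k N(0, s2_k); g_sigma = sum_k pi_k N(0, sigma^2 s2_k) *)
Definition gsig_sd (K : nat) (s2 : 'I_K.+1 -> R) (sigma2 : R) : 'I_K.+1 -> R :=
  fun k => Num.sqrt (sigma2 * s2 k).

(* the ELBO F(q, g, sigma^2) for a fully factorized q = prod_j q_j:
   F = log p(y|X,g,sigma^2) - D_KL(q || posterior), where the posterior has
   density lik(b)/p(y) w.r.t. the prior, so dq/dpost = (dq/dprior) p(y)/lik. *)
Definition ELBO (n p K : nat) (y : 'cV[R]_n) (X : 'M[R]_(n, p))
  (w s2 : 'I_K.+1 -> R) (sigma2 : R)
  (q : 'I_p -> 'I_K.+1 -> set R -> \bar R) : \bar R :=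
  let Pj := prior_slice w (gsig_sd s2 sigma2) in
  let py := prodE p (fun _ => Pj)
              (fun b _ => (expR (loglik y X sigma2 b))%:E) in
  if pselect (forall j, abs_cont (q j) Pj) then
    (lne py - prodE p (ext q)
       (fun b g => lne ((\prod_(j < p) dens (q j) Pj (g j) (b j)) * py
                        * ((expR (loglik y X sigma2 b))^-1)%:E)))%E
  else -oo%E.

Definition hfun (n p K : nat) (y : 'cV[R]_n) (X : 'M[R]_(n, p))
  (w s2 : 'I_K.+1 -> R) (sigma2 : R) (bbar : 'cV[R]_p) : \bar R :=
  (- ereal_sup [set v | exists q : 'I_p -> 'I_K.+1 -> {measure set R -> \bar R},
     [/\ forall j, is_dist (q j),
         forall j k, (q j k).-integrable setT (fun x => x%:E),
         forall j, dmean (fun k => q j k) = (bbar j ord0)%:E &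
         v = ELBO y X w s2 sigma2 (fun j k => q j k)]])%E.

End Defs.

(* Main.v *)
Require Import Defs.
From HB Require Import structures.
From mathcomp Require Import all_boot all_order all_algebra.
From mathcomp Require Import all_classical all_reals all_analysis measurable_realfun.
From mathcomp Require Import ring lra.
Set Implicit Arguments. Unset Strict Implicit. Unset Printing Implicit Defensive.
Import Order.TTheory GRing.Theory Num.Theory.
Import numFieldNormedType.Exports.
Local Open Scope classical_set_scope.
Local Open Scope ring_scope.

(* For a factorized [q] the integrand of the ELBO is a sum of log densities and
   of a quadratic form in [b].  Integrating one coordinate at a time replaces the
   coordinate by its mean and adds its variance, because the columns of [X] have
   norm 1; hence [- ELBO] is the residual sum of squares at the means plus one
   term per coordinate, and the infimum of this sum over independent factors is
   the sum of the infima.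

   For the penalty, let [phi] be the posterior density in the normal means model
   with observation [y].  Up to the constant [dual_value y m], the objective
   defining [rho m] is [s^2] times the Kullback-Leibler divergence from the
   posterior, for every [q] of mean [m].  By Gibbs' inequality
   [dual_value y m <= rho m], with equality when [m] is the posterior mean [S y].
   As [dual_value y] is explicit in [m], the bounds for [y] and [y'] squeeze
   the chord slopes of [rho] between [S y] and [S y'], and since [S] is
   continuous and increasing this determines the derivative. *)

(** * Integration without measurability, quasi-integrable functions, densities *)

Section integral_extra.
Local Open Scope ereal_scope.
Context d (T : measurableType d) (R : realType).
Implicit Types (mu : {measure set T -> \bar R}) (f g h : T -> \bar R).

Import HBNNSimple.

(* Unlike the library versions, these two lemmas do not ask for measurability,
   which is unknown for the integrands occurring in [iint]. *)
Lemma nonmeasurable_ge0_le_integral mu f g (N : set T) :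
  measurable N -> mu N = 0 -> (forall x, 0 <= f x) -> (forall x, 0 <= g x) ->
  (forall x, ~ N x -> f x <= g x) -> \int[mu]_x f x <= \int[mu]_x g x.
Proof.
move=> mN muN f0 g0 fg.
rewrite ge0_integralTE// ge0_integralTE//.
apply: ge_ereal_sup => _ /= [h hf <-].
have mNC : measurable (~` N) by exact: measurableC.
(* Setting a simple function [h <= f] to zero on the null set [N] keeps its integral and puts it
   below [g] everywhere. *)
pose h' := proj_nnsfun h mNC.
rewrite (_ : sintegral mu h = sintegral mu h'); last first.
  rewrite -!integralT_nnsfun; apply: ge0_ae_eq_integral => //.
  - exact/measurable_EFinP.
  - exact/measurable_EFinP.
  - by move=> x _; rewrite lee_fin.
  - by move=> x _; rewrite lee_fin.
  exists N; split => // x /=; apply: contra_notP => Nx _.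
  by rewrite /= mindicE mem_set// mulr1.
apply: ereal_sup_ubound; exists h' => //= x.
rewrite /= mindicE; have [Nx|Nx] := pselect (N x).
  by rewrite memNset ?mulr0//; apply.
by rewrite mem_set// mulr1 (le_trans (hf x))// fg.
Qed.

Lemma nonmeasurable_eq_integral mu f g (N : set T) :
  measurable N -> mu N = 0 -> (forall x, ~ N x -> f x = g x) ->
  \int[mu]_x f x = \int[mu]_x g x.
Proof.
move=> mN muN fg; rewrite integralE [RHS]integralE.
by congr (_ - _); apply/eqP; rewrite eq_le; apply/andP; split;
  apply: (@nonmeasurable_ge0_le_integral mu _ _ N) => //= x Nx;
  rewrite ?funeposE ?funenegE fg.
Qed.

(** Change of measure for a density that may take the value [+oo]: indicators first, then simple
    functions by linearity, then [h] by monotone convergence. *)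
Lemma integral_density (nu mu : {measure set T -> \bar R}) f h :
  measurable_fun setT f -> (forall x, 0 <= f x) ->
  (forall A, measurable A -> nu A = \int[mu]_(x in A) f x) ->
  measurable_fun setT h -> (forall x, 0 <= h x) ->
  \int[nu]_x h x = \int[mu]_x (h x * f x).
Proof.
move=> mf f0 nuE mh h0.
have indicP A : measurable A ->
    \int[nu]_x (\1_A x)%:E = \int[mu]_x ((\1_A x)%:E * f x).
  move=> mA; rewrite integral_indic// setIT nuE// integral_mkcond.
  apply: eq_integral => x _; rewrite patchE indicE.
  by case: (x \in A); rewrite ?mul1e ?mul0e.
have nnsfunP (k : {nnsfun T >-> R}) :
    \int[nu]_x (k x)%:E = \int[mu]_x ((k x)%:E * f x).
  under [LHS]eq_integral do rewrite fimfunE -fsumEFin//.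
  rewrite [LHS]ge0_integral_fsum//; last 2 first.
  - by move=> r; exact/measurable_EFinP/measurableT_comp.
  - by move=> n x _; rewrite EFinM nnfun_muleindic_ge0.
  under [RHS]eq_integral.
    move=> x xD; rewrite fimfunE -fsumEFin// ge0_mule_fsuml; last first.
      by move=> r; rewrite EFinM nnfun_muleindic_ge0.
    over.
  rewrite [RHS]ge0_integral_fsum//; last 2 first.
  - move=> r; apply: emeasurable_funM => //.
    exact/measurable_EFinP/measurableT_comp.
  - by move=> n x _; rewrite mule_ge0// EFinM nnfun_muleindic_ge0.
  apply: eq_fsbigr => r _.
  have [r0|r0] := ltP r 0%R.
    by rewrite !integral0_eq// => x _; rewrite preimage_nnfun0// indic0 mulr0// mul0e.
  under eq_integral do rewrite EFinM.
  under [RHS]eq_integral do rewrite EFinM -muleA.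
  rewrite !ge0_integralZl// ?indicP//.
  - by apply: emeasurable_funM => //; exact/measurable_EFinP.
  - by move=> x _; rewrite mule_ge0// lee_fin.
  all: try by rewrite lee_fin.
  all: try by move=> x _; rewrite ?mule_ge0// lee_fin.
  all: try exact/measurable_EFinP.
pose h_ := nnsfun_approx measurableT mh.
have cvgh x : (h_ n x)%:E @[n --> \oo] --> h x.
  by apply: cvg_nnsfun_approx => //; move=> *; exact: h0.
have ndh x : {homo (fun n => h_ n x) : m n / (m <= n)%N >-> (m <= n)%R}.
  by move=> m n mn; exact/lefP/nd_nnsfun_approx.
transitivity (limn (fun n => \int[nu]_x (h_ n x)%:E)).
  rewrite -monotone_convergence//=.
  - by apply: eq_integral => x _; apply/esym/cvg_lim.
  - by move=> n; exact/measurable_EFinP.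
  - by move=> n x _; rewrite lee_fin.
  - by move=> x _ a b ab; rewrite lee_fin ndh.
transitivity (limn (fun n => \int[mu]_x ((h_ n x)%:E * f x))).
  by under eq_fun do rewrite nnsfunP.
rewrite -monotone_convergence//=.
- apply: eq_integral => x _; apply/cvg_lim => //.
  have [->|fx0] := eqVneq (f x) 0.
    by rewrite mule0; under eq_fun do rewrite mule0; exact: cvg_cst.
  have := f0 x; case: (f x) fx0 => // [r r0 _|_ _]; first exact: cvgeZr.
  (* Here [f x = +oo]. If [h x = 0], all approximations vanish at [x]; otherwise they are eventually
     positive and the products are eventually [+oo]. *)
  have [hx0|hx0] := eqVneq (h x) 0.
    rewrite hx0 mul0e (_ : (fun _ => _) = cst 0); first exact: cvg_cst.
    apply/funext => n; suff -> : (h_ n x = 0)%R by rewrite mul0e.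
    apply/eqP; rewrite eq_le fun_ge0 andbT -lee_fin.
    rewrite [leRHS](_ : _ = h x); last by rewrite hx0.
    rewrite -(cvg_lim _ (cvgh x))//; apply: lime_ge.
      by apply/cvg_ex; exists (h x); exact: cvgh.
    by exists n => // m /= nm; rewrite lee_fin ndh.
  have [n0 hn0] : exists n, (0 < h_ n x)%R.
    apply: contrapT => /forallNP hn; move/eqP : hx0; apply.
    rewrite -(cvg_lim _ (cvgh x))//; apply/cvg_lim => //.
    rewrite (_ : (fun _ => _) = cst 0); first exact: cvg_cst.
    apply/funext => n; have /negP := hn n.
    by rewrite -leNgt => hn'; congr EFin; apply/eqP; rewrite eq_le hn' fun_ge0.
  rewrite gt0_muley ?lt0e ?hx0 ?h0//.
  apply: cvg_near_cst.
  exists n0 => // m /= nm; rewrite gt0_muley// lte_fin.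
  by rewrite (lt_le_trans hn0)// ndh.
- by move=> n; apply: emeasurable_funM => //; exact/measurable_EFinP.
- by move=> n x _; rewrite mule_ge0// lee_fin.
- by move=> x _ a b ab; rewrite lee_wpmul2r// lee_fin ndh.
Qed.

End integral_extra.

Section quasi_integrable.
Local Open Scope ereal_scope.
Context d (T : measurableType d) (R : realType).
Variable mu : {measure set T -> \bar R}.
Implicit Types f g : T -> \bar R.

(** The integral then has a meaning in []-oo, +oo]]. Log densities and squares satisfy this even
    when their integrals are infinite. *)
Definition qintegrable f := measurable_fun setT f /\ \int[mu]_x f^\- x < +oo.

Lemma integrable_qintegrable f : mu.-integrable setT f -> qintegrable f.
Proof.
by move=> fi; split; [exact: measurable_int fi|exact: integral_funeneg_lt_pinfty].
Qed.

Lemma ge0_qintegrable f :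
  measurable_fun setT f -> (forall x, 0 <= f x) -> qintegrable f.
Proof.
move=> mf f0; split => //.
by rewrite integral0_eq ?ltry// => x _; rewrite funenegE max_r// oppe_le0.
Qed.

Lemma qintegral_gtNy f : qintegrable f -> -oo < \int[mu]_x f x.
Proof.
move=> [mf fn]; rewrite integralE.
have p0 : 0 <= \int[mu]_x f^\+ x by exact: integral_ge0.
have n0 : 0 <= \int[mu]_x f^\- x by exact: integral_ge0.
apply: (@lt_le_trans _ _ (- \int[mu]_x f^\- x)).
  by rewrite lteNr.
by rewrite leeDr.
Qed.

Lemma le_qintegrable f g (N : set T) : measurable N -> mu N = 0 ->
  measurable_fun setT g -> qintegrable f ->
  (forall x, ~ N x -> f x <= g x) -> qintegrable g.
Proof.
move=> mN muN mg [mf fn] fg; split => //; apply: le_lt_trans fn.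
apply: (@nonmeasurable_ge0_le_integral _ _ _ _ _ _ N) => // x Nx.
by rewrite !funenegE ge_max !le_max leeN2 fg//= ?lexx ?orbT.
Qed.

Lemma le_qintegral f g (N : set T) : measurable N -> mu N = 0 ->
  (forall x, ~ N x -> f x <= g x) -> \int[mu]_x f x <= \int[mu]_x g x.
Proof.
move=> mN muN fg; rewrite integralE [leRHS]integralE; apply: leeB;
  apply: (@nonmeasurable_ge0_le_integral _ _ _ _ _ _ N) => // x Nx.
- by rewrite !funeposE ge_max !le_max fg//= ?lexx ?orbT.
- by rewrite !funenegE ge_max !le_max leeN2 fg//= ?lexx ?orbT.
Qed.

(** With [h = f + g], the identity [h^+ + f^- + g^- = h^- + f^+ + g^+] involves only nonnegative
    functions, so it can be integrated termwise; the negative parts have finite integrals and can be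
    moved back across. *)
Lemma qintegralD f g : qintegrable f -> qintegrable g ->
  (forall x, f x +? g x) ->
  \int[mu]_x (f x + g x) = \int[mu]_x f x + \int[mu]_x g x /\
  qintegrable (fun x => f x + g x).
Proof.
move=> [mf fn] [mg gn] fg.
pose h x := f x + g x.
have mh : measurable_fun setT h by exact: emeasurable_funD.
have mp (k : T -> \bar R) : measurable_fun setT k -> measurable_fun setT k^\+.
  exact: measurable_funepos.
have mn (k : T -> \bar R) : measurable_fun setT k -> measurable_fun setT k^\-.
  exact: measurable_funeneg.
have p0 (k : T -> \bar R) : 0 <= \int[mu]_x k^\+ x by exact: integral_ge0.
have n0 (k : T -> \bar R) : 0 <= \int[mu]_x k^\- x by exact: integral_ge0.
have hn : \int[mu]_x h^\- x < +oo.
  apply: (@le_lt_trans _ _ (\int[mu]_x (f^\- x + g^\- x))).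
    apply: (@nonmeasurable_ge0_le_integral _ _ _ _ _ _ set0) => //= x.
      by rewrite adde_ge0.
    move=> _; rewrite !funenegE ge_max; apply/andP; split; last first.
      by rewrite adde_ge0// le_max lexx orbT.
    rewrite oppeD//; apply: leeD; rewrite le_max lexx//.
  by rewrite ge0_integralD//; [exact: lte_add_pinfty|exact: mn|exact: mn].
split; last by [].
have E : \int[mu]_x h^\+ x + (\int[mu]_x f^\- x + \int[mu]_x g^\- x) =
         \int[mu]_x h^\- x + (\int[mu]_x f^\+ x + \int[mu]_x g^\+ x).
  rewrite -!ge0_integralD//; try by [exact: mp|exact: mn
    |move=> x _; rewrite adde_ge0
    |apply: emeasurable_funD; [exact: mp|exact: mp]
    |apply: emeasurable_funD; [exact: mn|exact: mn]].
  apply: eq_integral => x _; rewrite /h !funeposE !funenegE.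
  have := fg x; case: (f x) (g x) => [r| |] [s| |] //= _;
    rewrite ?(maxye, maxey, maxNye, maxeNy, addye, addey, adde0, add0e)//.
    rewrite -!EFin_max -!EFinD; congr EFin.
    have P (t : R) : Num.max t 0%R = (t + Num.max (- t) 0)%R.
      by rewrite /Num.max; case: ltP => ?; case: ltP => ?; lra.
    rewrite (P r) (P s) (P (r + s)%R); lra.
  all: try by rewrite -!EFin_max.
rewrite (integralE mu setT (fun x => f x + g x)) -/h (integralE mu setT f) (integralE mu setT g).
move: E hn fn gn (p0 h) (n0 h) (p0 f) (n0 f) (p0 g) (n0 g).
case: (\int[mu]_x h^\+ x) => [a| |] //; case: (\int[mu]_x h^\- x) => [b| |] //;
case: (\int[mu]_x f^\+ x) => [a1| |] //; case: (\int[mu]_x f^\- x) => [b1| |] //;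
case: (\int[mu]_x g^\+ x) => [a2| |] //; case: (\int[mu]_x g^\- x) => [b2| |] //=.
move=> [E] _ _ _ _ _ _ _ _ _; congr EFin; lra.
Qed.
End quasi_integrable.

Section density.
Local Open Scope ereal_scope.
Context d (T : measurableType d) (R : realType).
Variables (nu mu : {measure set T -> \bar R}) (f : T -> \bar R).
Hypotheses (mf : measurable_fun setT f) (f0 : forall x, 0 <= f x).
Hypothesis nuE : forall A, measurable A -> nu A = \int[mu]_(x in A) f x.

(** [nu] gives no mass to [f = 0] because it integrates [f] there, and none to [f = +oo] because
    that set is already [mu]-null, [f] being integrable. *)
Lemma density_pos_fin_off_null : nu setT < +oo ->
  exists N, [/\ measurable N, nu N = 0 &
    forall x, ~ N x -> (0 < fine (f x))%R /\ f x = (fine (f x))%:E].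
Proof.
move=> nu_fin.
pose N0 := [set x | f x = 0]; pose N1 := [set x | f x = +oo].
have mN0 : measurable N0.
  by rewrite /N0 -[X in measurable X]setTI; exact: (mf measurableT (emeasurable_set1 0)).
have mN1 : measurable N1.
  by rewrite /N1 -[X in measurable X]setTI; exact: (mf measurableT (emeasurable_set1 +oo)).
have N0_0 : nu N0 = 0 by rewrite nuE// integral0_eq.
have fint : mu.-integrable setT f.
  apply/integrableP; split => //.
  by under eq_integral do rewrite gee0_abs//; rewrite -nuE.
have N1_0 : nu N1 = 0.
  have [M [mM M0 fM]] := integrable_ae measurableT fint.
  have mu0 : mu N1 = 0.
    apply: (subset_measure0 mN1 mM) => // x; rewrite /N1 /= => fx.
    by apply: fM => /= /(_ I); rewrite fx.
  rewrite nuE//; apply: null_set_integral => //.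
  exact: measurable_funS mf.
exists (N0 `|` N1); split; first exact: measurableU.
  by rewrite measureU0.
move=> x /not_orP[fx0 fxy]; have := f0 x; move: fx0 fxy; rewrite /N0 /N1 /=.
case: (f x) => //= r r0 _; rewrite lee_fin le_eqVlt => /predU1P[r0'|//].
by exfalso; apply: r0; rewrite -r0'.
Qed.

(** The two integrands agree where [f] is positive and finite. Where [f] is [0] or [+oo],
    [fine (f x)] is [0] and the quotient is [0] by convention, hence only an inequality. *)
Lemma density_ratio_le (phi : T -> R) :
  measurable_fun setT phi -> (forall x, 0 <= phi x)%R ->
  \int[nu]_x (phi x / fine (f x))%:E <= \int[mu]_x (phi x)%:E.
Proof.
move=> mphi phi0.
have f0' x : (0 <= fine (f x))%R by exact: fine_ge0.
have mr : measurable_fun setT (fun x => (phi x / fine (f x))%:E).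
  apply/measurable_EFinP; apply: measurable_funM => //.
  rewrite (_ : (fun _ => _) = fun x => (fine (f x) `^ (-1))%R); last first.
    by apply/funext => x; rewrite powR_inv1.
  apply: (measurableT_comp (measurable_powR _)).
  by apply: measurableT_comp => //; exact: fine_measurable.
have r0 x : 0 <= (phi x / fine (f x))%:E by rewrite lee_fin divr_ge0.
rewrite (integral_density mf f0 nuE)//.
apply: ge0_le_integral => //.
- by move=> x _; rewrite mule_ge0.
- exact: emeasurable_funM.
- exact/measurable_EFinP.
move=> x _; have := f0 x; have := phi0 x; case: (f x) => [r p0 r0'| |]//=.
  rewrite -EFinM lee_fin; have [->|rN0] := eqVneq r 0%R; first by rewrite mulr0.
  by rewrite divfK.
by rewrite invr0 mulr0 mul0e.
Qed.

(** From [ln t >= 1 - 1 / t]: the negative part is at most [1 / f], whose [nu]-integral is at most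
    the mass of [mu]. *)
Lemma qintegrable_ln_density : nu setT < +oo -> mu setT < +oo ->
  qintegrable nu (fun x => (ln (fine (f x)))%:E).
Proof.
move=> nuy muy; have [N [mN N0 fN]] := density_pos_fin_off_null nuy.
have mL : measurable_fun setT (fun x => (ln (fine (f x)))%:E).
  apply/measurable_EFinP; apply: measurableT_comp; first exact: measurable_ln.
  by apply: measurableT_comp => //; exact: fine_measurable.
have f0' x : (0 <= fine (f x))%R by exact: fine_ge0.
have mr : measurable_fun setT (fun x => 1 / fine (f x))%R.
  rewrite (_ : (fun _ => _) = fun x => (fine (f x) `^ (-1))%R); last first.
    by apply/funext => x; rewrite powR_inv1// mul1r.
  apply: (measurableT_comp (measurable_powR _)).
  by apply: measurableT_comp => //; exact: fine_measurable.
apply: (@le_qintegrable _ _ _ _ (fun x => (1 - 1 / fine (f x))%:E) _ N) => //.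
  split; first by apply/measurable_EFinP; exact: measurable_funB.
  apply: (@le_lt_trans _ _ (\int[nu]_x (1 / fine (f x))%:E)).
    apply: (@nonmeasurable_ge0_le_integral _ _ _ _ _ _ set0) => // x.
      by rewrite lee_fin divr_ge0.
    move=> _; rewrite funenegE ge_max !lee_fin divr_ge0// andbT; lra.
  apply: (le_lt_trans (density_ratio_le _ _)) => //.
  by rewrite integral_cst// mul1e.
move=> x /fN[fx0 _]; rewrite lee_fin.
have := @expR_ge1Dx R (- ln (fine (f x))).
by rewrite expRN lnK ?posrE// div1r; lra.
Qed.

End density.

Section measure_of_density.
Local Open Scope ereal_scope.
Context d (T : measurableType d) (R : realType).
Variables (mu : {measure set T -> \bar R}) (f : T -> \bar R).
Hypotheses (mf : measurable_fun setT f) (f0 : forall x, 0 <= f x).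

Definition density_measure (A : set T) : \bar R := \int[mu]_(x in A) f x.

Let density_measure0 : density_measure set0 = 0.
Proof. exact: integral_set0. Qed.

Let density_measure_ge0 A : 0 <= density_measure A.
Proof. by apply: integral_ge0 => x _. Qed.

Let density_measure_sigma_additive : semi_sigma_additive density_measure.
Proof.
move=> A mA tA mUA; rewrite /density_measure ge0_integral_bigcup//; last first.
  exact: measurable_funS mf.
apply: is_cvg_ereal_nneg_natsum_cond => n _ _.
by apply: integral_ge0 => x _.
Qed.

Lemma ex_density_measure : exists nu : {measure set T -> \bar R},
  forall A, measurable A -> nu A = \int[mu]_(x in A) f x.
Proof.
pose b := isMeasure.Build _ _ _ density_measure density_measure0
  density_measure_ge0 density_measure_sigma_additive.
pose nu : {measure set T -> \bar R} := HB.pack density_measure b.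
by exists nu.
Qed.

End measure_of_density.

(** * Distributions given by slices and the Kullback-Leibler divergence *)

Lemma integrable_cst_lty d (T : measurableType d) (R : realType)
    (mu : {measure set T -> \bar R}) (r : R) :
  (mu setT < +oo)%E -> mu.-integrable setT (fun=> r%:E).
Proof.
move=> muy; apply/integrableP; split => //.
by rewrite /= integral_cst// lte_mul_pinfty.
Qed.

Section slices.
Local Open Scope ereal_scope.
Context (R : realType) (K : nat).
Implicit Types (q P : 'I_K.+1 -> {measure set R -> \bar R}).
Implicit Types (f : 'I_K.+1 -> R -> \bar R).

(** The integral over [R x 'I_K.+1] against the measure whose slices are the [q k]. *)
Definition slice_integral (q : 'I_K.+1 -> set R -> \bar R) f : \bar R :=
  \sum_(k < K.+1) \int[q k]_x f k x.

Lemma slice_mass_le1 q k : is_dist q -> q k setT <= 1.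
Proof.
by move=> <-; rewrite (bigD1 k)//= leeDl// sume_ge0// => i _.
Qed.

Lemma slice_mass_lty q k : is_dist q -> q k setT < +oo.
Proof. by move=> /(slice_mass_le1 k) /le_lt_trans; apply; rewrite ltry. Qed.

Lemma slice_integral_cst q (r : \bar R) : is_dist q -> -oo < r ->
  slice_integral q (fun _ _ => r) = r.
Proof.
move=> q1; rewrite /slice_integral.
under eq_bigr do rewrite (integral_cst _ measurableT).
case: r => [r _|_|//].
  by rewrite -fin_num_sume_distrr ?q1 ?mule1// => i j _ _; rewrite ge0_adde_def// inE.
by rewrite -ge0_sume_distrr// q1 mule1.
Qed.

Lemma le_slice_integral q f g :
  (forall k, exists N, [/\ measurable N, q k N = 0 &
     forall x, ~ N x -> f k x <= g k x]) ->
  slice_integral q f <= slice_integral q g.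
Proof.
by move=> fg; apply: lee_sum => k _; have [N [mN N0 H]] := fg k; exact: (le_qintegral mN N0).
Qed.

Lemma eq_slice_integral q f g :
  (forall k, exists N, [/\ measurable N, q k N = 0 &
     forall x, ~ N x -> f k x = g k x]) ->
  slice_integral q f = slice_integral q g.
Proof.
by move=> fg; apply: eq_bigr => k _; have [N [mN N0 H]] := fg k; exact: (nonmeasurable_eq_integral mN N0).
Qed.

Lemma slice_integralD q (f g : 'I_K.+1 -> R -> R) :
  (forall k, qintegrable (q k) (fun x => (f k x)%:E)) ->
  (forall k, qintegrable (q k) (fun x => (g k x)%:E)) ->
  slice_integral q (fun k x => (f k x + g k x)%:E) =
  slice_integral q (fun k x => (f k x)%:E) +
  slice_integral q (fun k x => (g k x)%:E) /\
  (forall k, qintegrable (q k) (fun x => (f k x + g k x)%:E)).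
Proof.
move=> fi gi; split.
  rewrite /slice_integral -big_split/=; apply: eq_bigr => k _.
  by have [<- _] := qintegralD (fi k) (gi k) (fun _ => isT).
by move=> k; have [] := qintegralD (fi k) (gi k) (fun _ => isT).
Qed.

Lemma slice_integral_gtNy q f : (forall k, qintegrable (q k) (f k)) ->
  -oo < slice_integral q f.
Proof.
move=> fi; rewrite /slice_integral ltNye; apply/negP => /eqP /esum_eqNyP.
by move=> [k [_ _]]; have := qintegral_gtNy (fi k) => /[swap] ->.
Qed.

Section mean_variance.
Variables (q : 'I_K.+1 -> {measure set R -> \bar R}) (m : R).
Hypotheses (q1 : is_dist q)
  (qi : forall k, (q k).-integrable setT (fun x => x%:E))
  (qm : dmean (fun k => q k) = m%:E).

Lemma slice_integrable_affine (a b : R) k :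
  (q k).-integrable setT (fun x => (a + b * (x - m))%:E).
Proof.
have qfin : q k setT < +oo by exact: slice_mass_lty.
under eq_fun do rewrite EFinD EFinM EFinB.
apply: integrableD => //; first exact: integrable_cst_lty.
apply: integrableZl => //; apply: integrableB => //.
exact: integrable_cst_lty.
Qed.

Lemma slice_integral_affine (a b : R) :
  slice_integral q (fun _ x => (a + b * (x - m))%:E) = a%:E.
Proof.
have qfin k : q k setT < +oo by exact: slice_mass_lty.
have ci k (r : R) : (q k).-integrable setT (fun=> r%:E).
  exact: integrable_cst_lty.
transitivity (\sum_(k < K.+1) (\int[q k]_x (a - b * m)%:E + b%:E * \int[q k]_x x%:E)).
  apply: eq_bigr => k _; rewrite -integralZl// -integralD//; last exact: integrableZl.
  by apply: eq_integral => x _; rewrite -EFinM -EFinD; congr EFin; ring.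
rewrite big_split/= -/(slice_integral q (fun _ _ => (a - b * m)%:E)).
rewrite slice_integral_cst ?ltNyr//.
rewrite -fin_num_sume_distrr//; last first.
  by move=> i j _ _; apply: fin_num_adde_defl; exact: integrable_fin_num.
by rewrite -/(dmean _) qm -EFinM -EFinD; congr EFin; ring.
Qed.

Lemma slice_integral_square (c : R) : (0 <= c)%R ->
  slice_integral q (fun _ x => (c * (x - m) ^+ 2)%:E) =
  c%:E * dvar (fun k => q k) m.
Proof.
move=> c0; rewrite /dvar ge0_sume_distrr; last first.
  by move=> k _; apply: integral_ge0 => x _; rewrite lee_fin sqr_ge0.
apply: eq_bigr => k _; rewrite -ge0_integralZl_EFin//.
- by move=> x _; rewrite lee_fin sqr_ge0.
- by apply/measurable_EFinP; apply: measurable_funX; exact: measurable_funB.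
Qed.

Lemma dvar_ge0 : 0 <= dvar (fun k => q k) m.
Proof.
by apply: sume_ge0 => k _; apply: integral_ge0 => x _; rewrite lee_fin sqr_ge0.
Qed.

(** The integrands of the penalty and of the ELBO both have this shape. The affine part is
    integrable, with its linear term killed by the mean, the square is nonnegative and [L] is
    quasi-integrable, so the integral splits even when the variance is infinite. *)
Lemma slice_integral_affine_square (L : 'I_K.+1 -> R -> R) (a b c : R) :
  (0 <= c)%R -> (forall k, qintegrable (q k) (fun x => (L k x)%:E)) ->
  slice_integral q (fun k x => (a + b * (x - m) + (c * (x - m) ^+ 2 + L k x))%:E) =
    a%:E + (c%:E * dvar (fun k => q k) m + slice_integral q (fun k x => (L k x)%:E)) /\
  (forall k, qintegrable (q k) (fun x => (a + b * (x - m) + (c * (x - m) ^+ 2 + L k x))%:E)).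
Proof.
move=> c0 Li.
have ai k := integrable_qintegrable (slice_integrable_affine a b k).
have si k : qintegrable (q k) (fun x => (c * (x - m) ^+ 2)%:E).
  apply: ge0_qintegrable => [|x]; last by rewrite lee_fin mulr_ge0// sqr_ge0.
  apply/measurable_EFinP; apply: measurable_funM => //.
  by apply: measurable_funX; exact: measurable_funB.
have [E1 i1] := slice_integralD si Li.
have [E2 i2] := slice_integralD ai i1.
by split=> //; rewrite E2 E1 slice_integral_affine slice_integral_square.
Qed.

End mean_variance.
End slices.

Lemma is_left_pselectT (Q : Prop) : Q -> is_left (pselect Q) = true.
Proof. by move=> q; case: (pselect Q). Qed.

Lemma is_left_pselectF (Q : Prop) : ~ Q -> is_left (pselect Q) = false.
Proof. by move=> q; case: (pselect Q). Qed.

Section kl.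
Local Open Scope ereal_scope.
Context (R : realType) (K : nat).
Variables (q P : 'I_K.+1 -> {measure set R -> \bar R}).
Hypotheses (q1 : is_dist q) (P1 : is_dist P).

Lemma densP : abs_cont (fun k => q k) (fun k => P k) ->
  is_density (fun k => q k) (fun k => P k) (dens (fun k => q k) (fun k => P k)).
Proof. by move=> qP; rewrite /dens; case: pselect => // h; case: cid. Qed.

Section density.
Variable f : 'I_K.+1 -> R -> \bar R.
Hypothesis qPf : is_density (fun k => q k) (fun k => P k) f.

Lemma slice_pos_fin_off_null k : exists N, [/\ measurable N, q k N = 0 &
  forall x, ~ N x -> (0 < fine (f k x))%R /\ f k x = (fine (f k x))%:E].
Proof.
have [mf [f0 qE]] := qPf k.
exact: (density_pos_fin_off_null mf f0 qE (slice_mass_lty k q1)).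
Qed.

Lemma slice_qintegrable_ln k : qintegrable (q k) (fun x => (ln (fine (f k x)))%:E).
Proof.
have [mf [f0 qE]] := qPf k.
exact: (qintegrable_ln_density mf f0 qE (slice_mass_lty k q1) (slice_mass_lty k P1)).
Qed.

Lemma measurable_fine_slice k : measurable_fun setT (fine \o f k).
Proof.
have [mf _] := qPf k.
by apply: measurableT_comp => //; exact: fine_measurable.
Qed.

Lemma qintegrable_slice_ratio (phi : 'I_K.+1 -> R -> R) k :
  measurable_fun setT (phi k) -> (forall x, 0 <= phi k x)%R ->
  qintegrable (q k) (fun x => (phi k x / fine (f k x))%:E).
Proof.
move=> mphi phi0; have [mf [f0 qE]] := qPf k.
have f0' x : (0 <= fine (f k x))%R by exact: fine_ge0.
apply: ge0_qintegrable => [|x]; last by rewrite lee_fin divr_ge0.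
apply/measurable_EFinP; apply: measurable_funM => //.
rewrite (_ : (fun _ => _) = fun x => (fine (f k x) `^ (-1))%R); last first.
  by apply/funext => x; rewrite powR_inv1.
by apply: (measurableT_comp (measurable_powR _)); exact: measurable_fine_slice.
Qed.

Lemma slice_ratio_le (phi : 'I_K.+1 -> R -> R) :
  (forall k, measurable_fun setT (phi k)) -> (forall k x, 0 <= phi k x)%R ->
  slice_integral q (fun k x => (phi k x / fine (f k x))%:E) <=
  slice_integral P (fun k x => (phi k x)%:E).
Proof.
move=> mphi phi0; apply: lee_sum => k _; have [mf [f0 qE]] := qPf k.
exact: (density_ratio_le mf f0 qE (mphi k) (phi0 k)).
Qed.

(* Gibbs' inequality, from [ln t >= 1 - 1 / t]. *)
Lemma gibbs_ge0 (phi h : 'I_K.+1 -> R -> R) :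
  (forall k, measurable_fun setT (phi k)) -> (forall k x, 0 < phi k x)%R ->
  slice_integral P (fun k x => (phi k x)%:E) <= 1 ->
  (forall k, qintegrable (q k) (fun x => (h k x)%:E)) ->
  (forall k x, (0 < fine (f k x))%R -> h k x = ln (fine (f k x)) - ln (phi k x))%R ->
  0 <= slice_integral q (fun k x => (h k x)%:E).
Proof.
move=> mphi phi0 phi1 hi hE.
have phi0' k x : (0 <= phi k x)%R by exact/ltW.
have [E _] := slice_integralD hi
  (fun k => qintegrable_slice_ratio (mphi k) (phi0' k)).
have r1 := le_trans (slice_ratio_le mphi phi0') phi1.
have : 1 <= slice_integral q (fun k x => (h k x + phi k x / fine (f k x))%:E).
  rewrite -[leLHS](slice_integral_cst q1) ?ltNyr//.
  apply: le_slice_integral => k; have [N [mN N0 fN]] := slice_pos_fin_off_null k.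
  exists N; split => // x /fN[fx0 _]; rewrite lee_fin hE//.
  have := @expR_ge1Dx R (ln (phi k x) - ln (fine (f k x))).
  by rewrite expRD expRN !lnK ?posrE//; lra.
rewrite E.
have aux (a r : \bar R) : r <= 1 -> 1 <= a + r -> 0 <= a.
  by move: a r => [a| |] [r| |] //; rewrite -EFinD !lee_fin => ? ?; lra.
exact: aux.
Qed.

End density.

(** Outside a [q]-null set the density is a positive real, so the extended logarithm is the real one
    there. *)
Lemma KL_ln : abs_cont (fun k => q k) (fun k => P k) ->
  KL (fun k => q k) (fun k => P k) =
  slice_integral q
    (fun k x => (ln (fine (dens (fun k => q k) (fun k => P k) k x)))%:E).
Proof.
move=> qP; rewrite /KL (is_left_pselectT qP).
apply: eq_slice_integral => k.
have [N [mN N0 fN]] := slice_pos_fin_off_null (densP qP) k.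
by exists N; split => // x /fN [fx0 {1}->]; rewrite lne_EFin.
Qed.

Lemma KL_gtNy : -oo < KL (fun k => q k) (fun k => P k).
Proof.
have [qP|qP] := pselect (abs_cont (fun k => q k) (fun k => P k)); last first.
  by rewrite /KL (is_left_pselectF qP).
rewrite KL_ln//; apply: slice_integral_gtNy => k.
exact: slice_qintegrable_ln (densP qP) k.
Qed.

(* Any two densities of [q] agree almost everywhere; this is all we need of it. *)
Lemma gibbs_le0 (phi h : 'I_K.+1 -> R -> R) f :
  (forall k, measurable_fun setT (phi k)) -> (forall k x, 0 < phi k x)%R ->
  is_density (fun k => q k) (fun k => P k) (fun k x => (phi k x)%:E) ->
  is_density (fun k => q k) (fun k => P k) f ->
  (forall k x, (0 < fine (f k x))%R -> h k x = ln (fine (f k x)) - ln (phi k x))%R ->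
  slice_integral q (fun k x => (h k x)%:E) <= 0.
Proof.
move=> mphi phi0 qphi qf hE.
have f0 k x : (0 <= fine (f k x))%R by apply: fine_ge0; have [_ []] := qf k.
have mf k := measurable_fine_slice qf k.
have ci k : qintegrable (q k) (fun x => (-1)%:E).
  by apply: integrable_qintegrable; apply: integrable_cst_lty; exact: slice_mass_lty.
have ri k : qintegrable (q k) (fun x => (fine (f k x) / phi k x)%:E).
  exact: (@qintegrable_slice_ratio _ qphi (fun k => fine \o f k) k (mf k) (f0 k)).
have [E _] := slice_integralD ri ci.
(* The inequality [ln t <= t - 1] with [t = f / phi]. *)
apply: (@le_trans _ _
    (slice_integral q (fun k x => (fine (f k x) / phi k x + -1)%:E))).
  apply: le_slice_integral => k.
  have [N [mN N0 fN]] := slice_pos_fin_off_null qf k.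
  exists N; split => // x /fN[fx0 _]; rewrite lee_fin hE//.
  have := @expR_ge1Dx R (ln (fine (f k x)) - ln (phi k x)).
  by rewrite expRD expRN !lnK ?posrE//; lra.
rewrite E slice_integral_cst ?ltNyr//.
suff r1 : slice_integral q (fun k x => (fine (f k x) / phi k x)%:E) <= 1.
  by rewrite -(@subee _ 1)// leeD2r.
(* With [phi] taken as the density of [q], the integral of [f / phi] is at most the [P]-integral of
   [f], which is the mass of [q]. *)
apply: (le_trans (@slice_ratio_le _ qphi (fun k => fine \o f k) mf f0)).
rewrite -[leRHS]q1; apply: lee_sum => k _.
have [mfk [f0k ->//]] := qf k.
apply: ge0_le_integral => //.
- by move=> x _; rewrite lee_fin; exact: f0.
- exact/measurable_EFinP.
move=> x _ /=; have := f0k x; move: (f k x) => [r _|_|//]; first exact: lexx.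
exact: leey.
Qed.

End kl.

(** * The normal means model *)

(** A zero integral would make [f] vanish almost everywhere, and then [A] would be a null set. *)
Lemma integral_gt0 d (T : measurableType d) (R : realType)
    (mu : {measure set T -> \bar R}) (f : T -> R) (A : set T) :
  measurable_fun setT f -> (forall x, 0 <= f x) -> (forall x, A x -> 0 < f x) ->
  measurable A -> (0 < mu A -> 0 < \int[mu]_x (f x)%:E)%E.
Proof.
move=> mf f0 fA mA muA; rewrite lt0e; apply/andP; split; last first.
  by apply: integral_ge0 => x _; rewrite lee_fin.
apply/eqP => I0.
have : ae_eq mu setT (EFin \o f) (cst 0%E).
  apply/ae_eq_integral_abs => //; first exact/measurable_EFinP.
  by under eq_integral do rewrite /= ger0_norm//.
move=> [N [mN N0 fN]]; suff : (mu A <= 0)%E by rewrite leNgt muA.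
rewrite -N0; apply: le_measure; rewrite ?inE// => x /fA fx; apply: fN => /=.
by move=> /(_ I) [] fx0; rewrite fx0 ltxx in fx.
Qed.

Lemma bounded_integrable d (T : measurableType d) (R : realType)
    (mu : {measure set T -> \bar R}) (f : T -> R) (M : R) :
  (mu setT < +oo)%E -> measurable_fun setT f -> (forall x, `|f x| <= M) ->
  mu.-integrable setT (fun x => (f x)%:E).
Proof.
move=> muy mf fM; apply: (le_integrable measurableT _ _ (integrable_cst_lty M muy)).
  exact/measurable_EFinP.
by move=> x _; rewrite /= lee_fin (le_trans (fM x))// ler_norm.
Qed.

Section normal_pdf_mean.
Context (R : realType).
Implicit Types s y b : R.

Lemma normal_pdf_expR s y b : 0 < s ->
  normal_pdf b s y = normal_peak s * expR (- (y - b) ^+ 2 / (s ^+ 2 *+ 2)).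
Proof. by move=> s0; rewrite /normal_pdf gt_eqF. Qed.

Lemma normal_pdfC s y b : 0 < s -> normal_pdf b s y = normal_pdf y s b.
Proof.
move=> s0; rewrite !normal_pdf_expR//.
by rewrite -(sqrrN (y - b)) opprB.
Qed.

Lemma measurable_normal_pdf_mean s y : 0 < s ->
  measurable_fun setT (fun b => normal_pdf b s y).
Proof.
by move=> s0; under eq_fun do rewrite normal_pdfC//; exact: measurable_normal_pdf.
Qed.

Lemma normal_pdf_gt0 s y b : 0 < s -> 0 < normal_pdf b s y.
Proof.
move=> s0; rewrite normal_pdf_expR// mulr_gt0 ?expR_gt0//.
by rewrite normal_peak_gt0// gt_eqF.
Qed.

Lemma ln_normal_pdf s y b : 0 < s ->
  ln (normal_pdf b s y) =
  - (ln (2 * pi * s ^+ 2) / 2) - (y - b) ^+ 2 / (2 * s ^+ 2).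
Proof.
move=> s0; rewrite normal_pdf_expR//.
have k0 : normal_peak s \is Num.pos by rewrite posrE normal_peak_gt0// gt_eqF.
have e0 x : expR x \is @Num.pos R by rewrite posrE expR_gt0.
rewrite (lnM k0 (e0 _)) expRK.
have t0 : 0 < s ^+ 2 * pi *+ 2 by rewrite pmulrn_lgt0// mulr_gt0 ?exprn_gt0 ?pi_gt0.
have q0 : Num.sqrt (s ^+ 2 * pi *+ 2) \is Num.pos by rewrite posrE sqrtr_gt0.
rewrite /normal_peak (lnV q0).
rewrite -powR12_sqrt ?ln_powR//; last exact: ltW.
have -> : 2 * pi * s ^+ 2 = s ^+ 2 * pi *+ 2 by rewrite -[RHS]mulr_natl -mulrA (mulrC pi).
have -> : s ^+ 2 *+ 2 = 2 * s ^+ 2 by rewrite mulr_natl.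
field; rewrite gt_eqF//.
Qed.

(** A bound uniform in [b] and locally uniform in [y], used for integrability and for domination.
    With [t = (y - b)^2 / (2 s^2)] it follows from [|b| <= |y| + 1 + (y - b)^2] and
    [t * expR (- t) <= 1]. *)
Lemma norm_mul_normal_pdf_le s y b : 0 < s ->
  `|b * normal_pdf b s y| <= normal_peak s * (`|y| + 1 + 2 * s ^+ 2).
Proof.
move=> s0; rewrite normrM (ger0_norm (normal_pdf_ge0 _ _ _)).
rewrite normal_pdf_expR// mulrCA ler_wpM2l ?normal_peak_ge0//.
rewrite mulNr; set t := (y - b) ^+ 2 / (s ^+ 2 *+ 2).
have s20 : 0 < s ^+ 2 *+ 2 by rewrite pmulrn_lgt0// exprn_gt0.
have t0 : 0 <= t by rewrite divr_ge0 ?sqr_ge0// ltW.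
have e1 : expR (- t) <= 1 by rewrite -expR0 ler_expR oppr_le0.
have te : t * expR (- t) <= 1.
  rewrite expRN ler_pdivrMr ?expR_gt0// mul1r (le_trans _ (expR_ge1Dx t))//; lra.
have e0 : 0 <= expR (- t) by exact: expR_ge0.
have yb : (y - b) ^+ 2 = t * (2 * s ^+ 2).
  by rewrite /t -[_ *+ 2]mulr_natl divfK// gt_eqF// mulr_gt0// exprn_gt0.
have bt : `|b| <= `|y| + 1 + t * (2 * s ^+ 2).
  rewrite -yb; have := ler_normD y (b - y); rewrite addrCA subrr addr0.
  have : `|b - y| <= 1 + (y - b) ^+ 2.
    rewrite -normr_id -sqrrN opprB -[in leRHS]real_normK ?num_real//.
    have := sqr_ge0 (`|b - y| - 1); have := normr_ge0 (b - y).
    rewrite normr_id; move: `|b - y| => r r0.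
    by rewrite (_ : (r - 1) ^+ 2 = r ^+ 2 - 2 * r + 1); [lra|ring].
  by lra.
apply: (le_trans (ler_wpM2r e0 bt)).
rewrite mulrDl mulrAC; apply: lerD.
  by rewrite ler_piMr// addr_ge0.
by rewrite ler_piMl// mulr_ge0// sqr_ge0.
Qed.

End normal_pdf_mean.

Lemma integral_density_EFin d (T : measurableType d) (R : realType)
    (nu mu : {measure set T -> \bar R}) (f h : T -> R) :
  measurable_fun setT f -> (forall x, 0 <= f x) ->
  (forall A, measurable A -> nu A = \int[mu]_(x in A) (f x)%:E)%E ->
  measurable_fun setT h ->
  (\int[nu]_x (h x)%:E = \int[mu]_x (h x * f x)%:E)%E.
Proof.
move=> mf f0 nuE mh.
have mf' : measurable_fun setT (EFin \o f) by exact/measurable_EFinP.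
have mh' : measurable_fun setT (EFin \o h) by exact/measurable_EFinP.
have f0' x : (0 <= (EFin \o f) x)%E by rewrite lee_fin.
rewrite integralE [RHS]integralE; congr (_ - _)%E.
- rewrite (integral_density mf' f0' nuE)//; last exact: measurable_funepos.
  apply: eq_integral => x _; rewrite !funeposE /= -!EFin_max -EFinM.
  by rewrite maxr_pMl// mul0r.
- rewrite (integral_density mf' f0' nuE)//; last exact: measurable_funeneg.
  apply: eq_integral => x _; rewrite !funenegE /= -!EFin_max -EFinM.
  by rewrite maxr_pMl// mul0r mulNr.
Qed.

Section normal_means.
Context (R : realType) (K : nat).
Variables (P : 'I_K.+1 -> {measure set R -> \bar R}) (s : R).
Hypotheses (P1 : is_dist P) (s0 : 0 < s).
Implicit Types y m : R.

Definition marginal y : R :=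
  fine (slice_integral P (fun _ b => (normal_pdf b s y)%:E)).
Definition unnormalized_mean y : R :=
  fine (slice_integral P (fun _ b => (b * normal_pdf b s y)%:E)).
Definition posterior_mean y : R := unnormalized_mean y / marginal y.

Let Pfin k : (P k setT < +oo)%E. Proof. exact: slice_mass_lty. Qed.

Lemma slice_fin_num (h : 'I_K.+1 -> R -> \bar R) :
  (forall k, (P k).-integrable setT (h k)) -> slice_integral P h \is a fin_num.
Proof. by move=> hi; apply/sum_fin_numP => k _ _; exact: integrable_fin_num. Qed.

Lemma integrable_normal_pdf_mean k y :
  (P k).-integrable setT (fun b => (normal_pdf b s y)%:E).
Proof.
apply: (@bounded_integrable _ _ _ _ _ (normal_peak s)) => //.
  exact: measurable_normal_pdf_mean.
by move=> b; rewrite ger0_norm ?normal_pdf_ge0// normal_pdf_ub// gt_eqF.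
Qed.

Lemma measurable_mul_normal_pdf y : measurable_fun setT (fun b : R => b * normal_pdf b s y).
Proof. by apply: measurable_funM => //; exact: measurable_normal_pdf_mean. Qed.

Lemma integrable_mul_normal_pdf k y :
  (P k).-integrable setT (fun b => (b * normal_pdf b s y)%:E).
Proof.
apply: (@bounded_integrable _ _ _ _ _ (normal_peak s * (`|y| + 1 + 2 * s ^+ 2))) => //.
  exact: measurable_mul_normal_pdf.
by move=> b; exact: norm_mul_normal_pdf_le.
Qed.

Lemma marginalE y :
  slice_integral P (fun _ b => (normal_pdf b s y)%:E) = (marginal y)%:E.
Proof. by rewrite fineK// slice_fin_num// => k; exact: integrable_normal_pdf_mean. Qed.

Lemma unnormalized_meanE y :
  slice_integral P (fun _ b => (b * normal_pdf b s y)%:E) = (unnormalized_mean y)%:E.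
Proof. by rewrite fineK// slice_fin_num// => k; exact: integrable_mul_normal_pdf. Qed.

Lemma slice_mass_gt0 : exists k, (0 < P k setT)%E.
Proof.
apply: contrapT => /forallNP H; have := @esym _ _ _ P1.
rewrite big1 => [/eqP|k _]; first by rewrite eqe oner_eq0.
by apply/eqP; rewrite eq_le measure_ge0 andbT leNgt; apply/negP.
Qed.

Lemma marginal_gt0 y : 0 < marginal y.
Proof.
rewrite -lte_fin -marginalE; have [k Pk] := slice_mass_gt0.
rewrite /slice_integral (bigD1 k)//=.
have pk : (0 < \int[P k]_b (normal_pdf b s y)%:E)%E.
  apply: (@integral_gt0 _ _ _ _ _ setT) => //.
  - exact: measurable_normal_pdf_mean.
  - by move=> b; exact: normal_pdf_ge0.
  - by move=> b _; exact: normal_pdf_gt0.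
apply: (lt_le_trans pk); rewrite leeDl//.
by apply: sume_ge0 => i _; apply: integral_ge0 => b _; rewrite lee_fin normal_pdf_ge0.
Qed.

(** The density with respect to the prior [P], not to Lebesgue measure; it is the same function on
    every slice. *)
Definition posterior_density y b : R := normal_pdf b s y / marginal y.

Lemma measurable_posterior_density y : measurable_fun setT (posterior_density y).
Proof. by apply: measurable_funM => //; exact: measurable_normal_pdf_mean. Qed.

Lemma posterior_density_gt0 y b : 0 < posterior_density y b.
Proof. by rewrite divr_gt0 ?normal_pdf_gt0// marginal_gt0. Qed.

Lemma slice_integral_div (h : 'I_K.+1 -> R -> R) y r :
  (forall k, (P k).-integrable setT (fun b => (h k b)%:E)) ->
  slice_integral P (fun k b => (h k b)%:E) = r%:E ->
  slice_integral P (fun k b => (h k b / marginal y)%:E) = (r / marginal y)%:E.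
Proof.
move=> hi hr; rewrite EFinM -hr muleC /slice_integral.
rewrite fin_num_sume_distrr//; last first.
  by move=> i j _ _; apply: fin_num_adde_defl; exact: integrable_fin_num.
apply: eq_bigr => k _; rewrite -integralZl//.
by apply: eq_integral => x _; rewrite -EFinM mulrC.
Qed.

Lemma slice_integral_posterior_density y :
  slice_integral P (fun _ b => (posterior_density y b)%:E) = 1%:E.
Proof.
rewrite (slice_integral_div (h := fun _ b => normal_pdf b s y) y (fun k => integrable_normal_pdf_mean k y) (marginalE y)).
by rewrite divff// gt_eqF// marginal_gt0.
Qed.

(** The posterior is the competitor that attains the infimum in the penalty at
    [posterior_mean y]. *)
Lemma ex_posterior y : exists q : 'I_K.+1 -> {measure set R -> \bar R},
  [/\ is_dist q,
      forall k, (q k).-integrable setT (fun x => x%:E),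
      dmean (fun k => q k) = (posterior_mean y)%:E &
      is_density (fun k => q k) (fun k => P k)
        (fun _ b => (posterior_density y b)%:E)].
Proof.
have mphi : measurable_fun setT (EFin \o posterior_density y).
  by apply/measurable_EFinP; exact: measurable_posterior_density.
have phi0 b : (0 <= (EFin \o posterior_density y) b)%E.
  by rewrite lee_fin ltW// posterior_density_gt0.
have phi0' b : 0 <= posterior_density y b by rewrite ltW// posterior_density_gt0.
have /choice[q qE] k := ex_density_measure (P k) mphi phi0.
have qh k (h : R -> R) : measurable_fun setT h ->
    (\int[q k]_x (h x)%:E = \int[P k]_x (h x * posterior_density y x)%:E)%E.
  by move=> mh; apply: (integral_density_EFin (measurable_posterior_density y) phi0' (qE k) mh).
exists q; split.
- by rewrite /is_dist -(slice_integral_posterior_density y); apply: eq_bigr => k _; exact: qE.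
- move=> k; apply/integrableP; split; first exact/measurable_EFinP.
  rewrite (eq_integral (fun x : R => (`|x|)%:E))//.
  rewrite (qh k (fun x => `|x|))//.
  under eq_integral => x _.
    rewrite (_ : (_ * _)%:E = `|(x * normal_pdf x s y / marginal y)%:E|)%E; last first.
      by rewrite /= -mulrA normrM (ger0_norm (phi0' _)).
    over.
  suff : (P k).-integrable setT (fun x => (x * normal_pdf x s y / marginal y)%:E).
    by move/integrableP => [].
  under eq_fun do rewrite mulrC EFinM.
  by apply: integrableZl => //; exact: integrable_mul_normal_pdf.
- rewrite -(slice_integral_div (h := fun _ b => b * normal_pdf b s y) y (fun k => integrable_mul_normal_pdf k y) (unnormalized_meanE y)).
  by apply: eq_bigr => k _; rewrite (qh k id)//; apply: eq_integral => x _; rewrite mulrA.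
- by move=> k; split => //; split => //; exact: qE.
Qed.

(** The bound [dual_value y m <= rho m] says that [(y - m)^2 / 2 + rho m] is at least [- s^2] times
    the marginal log-likelihood at [y]. *)
Definition dual_value y m : R := - (s ^+ 2 * ln (marginal y)) - (y - m) ^+ 2 / 2.

Definition objective (q : 'I_K.+1 -> {measure set R -> \bar R}) m : \bar R :=
  ((s ^+ 2 / 2 * ln (2 * pi * s ^+ 2))%:E
   + (1 / 2)%:E * dvar (fun k => q k) m
   + (s ^+ 2)%:E * KL (fun k => q k) (fun k => P k))%E.

Section log_ratio.
Variables (y m : R) (f : 'I_K.+1 -> R -> \bar R).

(* [ln (f / posterior_density y)], expanded around [m]. *)
Definition log_ratio k x : R :=
  (s ^+ 2)^-1 * ((y - m) ^+ 2 / 2 + s ^+ 2 * ln (marginal y)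
                 + s ^+ 2 / 2 * ln (2 * pi * s ^+ 2))
  + (m - y) / s ^+ 2 * (x - m)
  + ((2 * s ^+ 2)^-1 * (x - m) ^+ 2 + ln (fine (f k x))).

Lemma log_ratioE k x : 0 < fine (f k x) ->
  log_ratio k x = ln (fine (f k x)) - ln (posterior_density y x).
Proof.
move=> fx0; rewrite /posterior_density ln_div ?posrE ?normal_pdf_gt0 ?marginal_gt0//.
rewrite ln_normal_pdf// /log_ratio; field; rewrite gt_eqF//.
Qed.

Variable q : 'I_K.+1 -> {measure set R -> \bar R}.
Hypotheses (q1 : is_dist q)
  (qi : forall k, (q k).-integrable setT (fun x => x%:E))
  (qm : dmean (fun k => q k) = m%:E).
Hypothesis qf : is_density (fun k => q k) (fun k => P k) f.

Let c0 : 0 <= (2 * s ^+ 2)^-1.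
Proof. by rewrite invr_ge0 mulr_ge0// sqr_ge0. Qed.

Let E := slice_integral_affine_square q1 qi qm
  ((s ^+ 2)^-1 * ((y - m) ^+ 2 / 2 + s ^+ 2 * ln (marginal y)
                 + s ^+ 2 / 2 * ln (2 * pi * s ^+ 2))) ((m - y) / s ^+ 2) c0
  (slice_qintegrable_ln q1 P1 qf).

Lemma qintegrable_log_ratio k : qintegrable (q k) (fun x => (log_ratio k x)%:E).
Proof. by case: E => _; exact. Qed.

Lemma slice_integral_log_ratio :
  slice_integral q (fun k x => (log_ratio k x)%:E) =
  (((s ^+ 2)^-1 * ((y - m) ^+ 2 / 2 + s ^+ 2 * ln (marginal y)
                 + s ^+ 2 / 2 * ln (2 * pi * s ^+ 2)))%:E
  + ((2 * s ^+ 2)^-1%:E * dvar (fun k => q k) m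
     + slice_integral q (fun k x => (ln (fine (f k x)))%:E)))%E.
Proof. by case: E. Qed.

End log_ratio.

(** Completing the square around the observation [y] turns variance plus divergence from the prior
    into the divergence from the posterior. Neither term is [-oo], so the two sides are infinite
    together. *)
Lemma objectiveE q y m : is_dist q ->
  (forall k, (q k).-integrable setT (fun x => x%:E)) ->
  dmean (fun k => q k) = m%:E ->
  abs_cont (fun k => q k) (fun k => P k) ->
  objective q m = ((dual_value y m)%:E + (s ^+ 2)%:E *
    slice_integral q (fun k x => (log_ratio y m (dens (fun k => q k) (fun k => P k)) k x)%:E))%E.
Proof.
move=> q1 qi qm qP; rewrite /objective KL_ln//.
rewrite (slice_integral_log_ratio y q1 qi qm (densP qP)).
have : (-oo < slice_integral q (fun k x =>
    (ln (fine (dens (fun k => q k) (fun k => P k) k x)))%:E))%E.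
  by apply: slice_integral_gtNy => k; exact: slice_qintegrable_ln (densP qP) k.
move: (slice_integral q _) (dvar_ge0 q m) => L; move: (dvar _ m) => V.
have s20 : 0 < s ^+ 2 by rewrite exprn_gt0.
have sy : ((s ^+ 2)%:E * +oo = +oo :> \bar R)%E by rewrite gt0_muley.
have hy : ((1 / 2)%:E * +oo = +oo :> \bar R)%E by rewrite gt0_muley// lte_fin; lra.
have vy : ((2 * s ^+ 2)^-1%:E * +oo = +oo :> \bar R)%E.
  by rewrite gt0_muley// lte_fin invr_gt0 mulr_gt0.
case: V => [v| |] //; case: L => [l| |] // _ _; rewrite ?vy ?sy ?hy ?addey ?addye ?sy ?addey//.
rewrite /=; congr EFin.
rewrite /dual_value; field; rewrite gt_eqF//.
Qed.

Lemma objective_ge q y m : is_dist q ->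
  (forall k, (q k).-integrable setT (fun x => x%:E)) ->
  dmean (fun k => q k) = m%:E -> ((dual_value y m)%:E <= objective q m)%E.
Proof.
move=> q1 qi qm.
have [qP|qP] := pselect (abs_cont (fun k => q k) (fun k => P k)); last first.
  (* Without a density the divergence, and with it the objective, is [+oo]. *)
  rewrite /objective /KL (is_left_pselectF qP) gt0_muley ?lte_fin ?exprn_gt0//.
  rewrite addey ?leey// gt_eqF// (@lt_le_trans _ _ (s ^+ 2 / 2 * ln (2 * pi * s ^+ 2))%:E) ?ltNyr//.
  by rewrite leeDl// mule_ge0 ?lee_fin// dvar_ge0.
rewrite (objectiveE y q1 qi qm qP) leeDl// mule_ge0 ?lee_fin ?sqr_ge0//.
apply: (gibbs_ge0 q1 (densP qP) (phi := fun _ => posterior_density y)).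
- by move=> _; exact: measurable_posterior_density.
- by move=> _; exact: posterior_density_gt0.
- by rewrite slice_integral_posterior_density.
- by apply: qintegrable_log_ratio => //; exact: densP.
- by move=> k x; exact: log_ratioE.
Qed.

(** The equality case of Gibbs' inequality. The density chosen by [dens] need not be
    [posterior_density y] itself, which is why [gibbs_le0] compares two densities of the same
    [q]. *)
Lemma objective_posterior_le q y : is_dist q ->
  (forall k, (q k).-integrable setT (fun x => x%:E)) ->
  dmean (fun k => q k) = (posterior_mean y)%:E ->
  is_density (fun k => q k) (fun k => P k) (fun _ b => (posterior_density y b)%:E) ->
  (objective q (posterior_mean y) <= (dual_value y (posterior_mean y))%:E)%E.
Proof.
move=> q1 qi qm qphi.
have qP : abs_cont (fun k => q k) (fun k => P k) by exists (fun _ b => (posterior_density y b)%:E).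
rewrite (objectiveE y q1 qi qm qP) geeDl// mule_ge0_le0 ?lee_fin ?sqr_ge0//.
apply: (gibbs_le0 q1 (phi := fun _ => posterior_density y) _ _ qphi (densP qP)).
- by move=> _; exact: measurable_posterior_density.
- by move=> _; exact: posterior_density_gt0.
- by move=> k x; exact: log_ratioE.
Qed.

Section rho.
Variables w u : 'I_K.+1 -> R.
Hypothesis PE : prior_slice w u = (fun k => P k).

Lemma rhoE m : rho w u s m = ereal_inf [set v | exists q : 'I_K.+1 -> {measure set R -> \bar R},
    [/\ is_dist q, forall k, (q k).-integrable setT (fun x => x%:E),
        dmean (fun k => q k) = m%:E & v = objective q m]].
Proof. by rewrite /rho PE. Qed.

Lemma rho_ge y m : ((dual_value y m)%:E <= rho w u s m)%E.
Proof.
by rewrite rhoE; apply: le_ereal_inf_tmp => _ [q [q1 qi qm ->]]; exact: objective_ge.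
Qed.

Lemma rho_posterior_mean y :
  rho w u s (posterior_mean y) = (dual_value y (posterior_mean y))%:E.
Proof.
apply/eqP; rewrite eq_le rho_ge andbT rhoE.
have [q [q1 qi qm qphi]] := ex_posterior y.
apply: le_trans (objective_posterior_le q1 qi qm qphi).
by apply: ereal_inf_lbound; exists q.
Qed.

Lemma nm_marginalE y : nm_marginal w u s y = (marginal y)%:E.
Proof. by rewrite /nm_marginal PE -marginalE. Qed.

Lemma S_NME y : S_NM w u s y = posterior_mean y.
Proof. by rewrite /S_NM nm_marginalE PE. Qed.

End rho.
End normal_means.

(* [y' - (S y' + S y) / 2] and [y - (S y' + S y) / 2] bracket the slope of the
   chord of [r] from [S y] to [S y']. *)
Lemma is_derive_chord_slopes (R : realType) (S r : R -> R) (y0 : R) :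
  continuous S -> {homo S : x y / x < y} ->
  (forall y y', (S y' - S y) * (y - (S y' + S y) / 2) <= r (S y') - r (S y)) ->
  is_derive (S y0) 1 r (y0 - S y0).
Proof.
move=> cS iS chord.
suff cr : h^-1 *: ((r \o shift (S y0)) (h *: 1) - r (S y0)) @[h --> 0^'] --> y0 - S y0.
  apply: DeriveDef; first by apply/cvg_ex; exists (y0 - S y0).
  exact: cvg_lim cr.
apply/cvgrPdist_le => e e0.
have e20 : 0 < e / 2 by rewrite divr_gt0.
(* For small [h] the point [S y0 + h] lies between these two values, so the intermediate value
   theorem gives [y] within [e / 2] of [y0] with [S y = S y0 + h]. *)
have lo : S (y0 - e / 2) < S y0 by apply: iS; lra.
have hi : S y0 < S (y0 + e / 2) by apply: iS; lra.
near=> h.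
have h0 : h != 0 by near: h; exact: nbhs_dnbhs_neq.
have he : `|h| <= e by near: h; apply: dnbhs0_le.
have hlo : `|h| <= S y0 - S (y0 - e / 2).
  by near: h; apply: dnbhs0_le; rewrite subr_gt0.
have hhi : `|h| <= S (y0 + e / 2) - S y0.
  by near: h; apply: dnbhs0_le; rewrite subr_gt0.
have {}hlo : S (y0 - e / 2) <= h + S y0 by have := ler_norm (- h); rewrite normrN; lra.
have {}hhi : h + S y0 <= S (y0 + e / 2) by have := ler_norm h; lra.
have [y yI yE] : exists2 y, y \in `[y0 - e / 2, y0 + e / 2] & S y = h + S y0.
  apply: IVT; [by lra|exact: continuous_subspaceT|].
  rewrite min_l ?max_r ?hlo ?hhi//; lra.
(* The pair [(y0, y)] bounds the increment of [r] from below, the pair [(y, y0)] from above. *)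
have h1 := chord y0 y; have h2 := chord y y0; rewrite yE in h1 h2.
rewrite /= scaler1 /GRing.scale/=.
move: yI; rewrite in_itv/= => /andP[ylo yhi].
set D := r _ - r _ in h1 *.
have {}h1 : h * (y0 - S y0 - h / 2) <= D by move: h1; congr (_ <= _); field.
have {}h2 : D <= h * (y - S y0 - h / 2).
  by rewrite -subr_ge0; move: h2; rewrite -subr_ge0; congr (_ <= _); rewrite /D; field.
(* Dividing by [h] swaps the bounds when [h < 0]. Both lie within [e / 2 + |h| / 2 <= e] of
   [y0 - S y0]. *)
have [hneg|hpos|/eqP] := ltgtP h 0; last by rewrite (negbTE h0).
- have q1 : h^-1 * D <= y0 - S y0 - h / 2.
    by rewrite [h^-1 * D]mulrC ler_ndivrMr// [_ * h]mulrC.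
  have q2 : y - S y0 - h / 2 <= h^-1 * D.
    by rewrite [h^-1 * D]mulrC ler_ndivlMr// [_ * h]mulrC.
  by move: he; rewrite ltr0_norm// => he; rewrite ler_norml; apply/andP; split; lra.
- have q1 : y0 - S y0 - h / 2 <= h^-1 * D.
    by rewrite [h^-1 * D]mulrC ler_pdivlMr// [_ * h]mulrC.
  have q2 : h^-1 * D <= y - S y0 - h / 2.
    by rewrite [h^-1 * D]mulrC ler_pdivrMr// [_ * h]mulrC.
  by move: he; rewrite gtr0_norm// => he; rewrite ler_norml; apply/andP; split; lra.
Unshelve. all: by end_near. Qed.

(* The library equips [normal_prob] with a measure structure for another
   display on [R] than the one of [{measure set R -> \bar R}]. *)
Lemma ex_normal_measure (R : realType) (u : R) :
  exists N : {measure set R -> \bar R}, (N : set R -> \bar R) = normal_prob 0 u.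
Proof.
pose N0 : {measure set _ -> \bar R} := normal_prob 0 u.
pose b := isMeasure.Build _ R R (N0 : set R -> \bar R) (measure0 N0)
  (measure_ge0 N0) (@measure_semi_sigma_additive _ _ _ N0).
pose N : {measure set R -> \bar R} := HB.pack (N0 : set R -> \bar R) b.
by exists N.
Qed.

(** * The mixture prior as a family of measures *)

Section prior_measure.
Context (R : realType) (K : nat).
Variables w u : 'I_K.+1 -> R.
Hypothesis w0 : forall k, 0 <= w k.

Lemma ex_prior_measure : exists P : 'I_K.+1 -> {measure set R -> \bar R},
  prior_slice w u = (fun k => P k).
Proof.
have /choice[N NE] k : exists N : {measure set R -> \bar R},
    (N : set R -> \bar R) = normal0 (u k).
  rewrite /normal0; case: ifP => _; last exact: ex_normal_measure.
  by exists (dirac (0 : R)).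
exists (fun k => mscale (NngNum (w0 k)) (N k)).
by apply/funext => k; apply/funext => A; rewrite /prior_slice -NE.
Qed.

Lemma prior_slice_setT k : prior_slice w u k setT = (w k)%:E.
Proof.
rewrite /prior_slice /normal0; case: ifP => _.
  by rewrite diracT mule1.
by rewrite probability_setT mule1.
Qed.

(** A normal law with nonzero standard deviation has no atoms. *)
Lemma prior_slice_setC1 k m : u k != 0 -> prior_slice w u k (~` [set m]) = (w k)%:E.
Proof.
move=> uk; rewrite /prior_slice /normal0 (negbTE uk) probability_setC//.
rewrite [X in (1 - X)%E](_ : _ = 0%E) ?sube0 ?mule1//.
exact: integral_set1.
Qed.

End prior_measure.

(** * Continuity and strict monotonicity of the posterior mean *)

Section posterior_mean_regularity.
Context (R : realType) (K : nat).
Variables (P : 'I_K.+1 -> {measure set R -> \bar R}) (s : R).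
Hypotheses (P1 : is_dist P) (s0 : 0 < s).

(** Continuity under the integral sign: on []a - 1, a + 1[] the integrand is dominated by the
    constant [M (|a| + 1)], integrable because the slices have finite mass. *)
Lemma continuous_slice_integral (f : R -> R -> R) (M : R -> R) :
  (forall y k, (P k).-integrable setT (fun b => (f y b)%:E)) ->
  (forall b, continuous (f ^~ b)) ->
  (forall y b, `|f y b| <= M `|y|) -> {homo M : x y / x <= y} ->
  continuous (fun y => fine (slice_integral P (fun _ b => (f y b)%:E))).
Proof.
move=> fi cf fM Mh a.
rewrite (_ : (fun y => _) = fun y => \sum_(k < K.+1) \int[P k]_b (f y b)); last first.
  apply/funext => y; rewrite /slice_integral.
  rewrite (eq_bigr (fun k => (\int[P k]_b (f y b))%R%:E)) ?sumEFin// => k _.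
  by rewrite /Rintegral fineK//; exact: integrable_fin_num.
suff cF k : (fun y => \int[P k]_b (f y b)) @ a --> \int[P k]_b (f a b).
  have cl (l : seq 'I_K.+1) : (fun y => \sum_(k <- l) \int[P k]_b (f y b)) @ a -->
      \sum_(k <- l) \int[P k]_b (f a b); last exact: cl.
  elim: l => [|k l IH].
    by rewrite big_nil; under eq_fun do rewrite big_nil; exact: cvg_cst.
  rewrite big_cons; under eq_fun do rewrite big_cons.
  exact: (@cvgD _ R^o).
apply: (@continuity_under_integral _ _ _ (P k) f setT measurableT (a - 1) (a + 1)
  _ _ (fun=> M (`|a| + 1))) => //.
- by move=> x _; exact: fi.
- by apply: aeW => b _ x _; exact: cf.
- by apply: integrable_cst_lty; exact: slice_mass_lty.
- move=> x /=; rewrite in_itv/= => /andP[x1 x2]; apply: aeW => b _.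
  apply: (le_trans (fM x b)); apply: Mh.
  have := ler_normD a (x - a); rewrite addrCA subrr addr0 => /le_trans; apply.
  by rewrite lerD2l ler_norml; apply/andP; split; lra.
- by rewrite inE/= in_itv/=; apply/andP; split; lra.
Qed.

Lemma continuous_normal_pdf_arg b : continuous (fun y => normal_pdf b s y).
Proof. by apply: continuous_normal_pdf; rewrite gt_eqF. Qed.

Lemma continuous_posterior_mean : continuous (posterior_mean P s).
Proof.
move=> y; apply: (@cvgM R^o).
- apply: (@continuous_slice_integral (fun y b => b * normal_pdf b s y)
    (fun t => normal_peak s * (t + 1 + 2 * s ^+ 2))).
  + by move=> z k; exact: integrable_mul_normal_pdf.
  + move=> b z; apply: (@cvgM R^o); [exact: cvg_cst|exact: continuous_normal_pdf_arg].
  + by move=> z b; exact: norm_mul_normal_pdf_le.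
  + by move=> x z xz; rewrite ler_wpM2l ?normal_peak_ge0// !lerD2r.
- apply: cvgV; first by rewrite gt_eqF// marginal_gt0.
  apply: (@continuous_slice_integral (fun y b => normal_pdf b s y) (fun _ => normal_peak s)) => //.
  + by move=> z k; exact: integrable_normal_pdf_mean.
  + by move=> b z; exact: continuous_normal_pdf_arg.
  + by move=> z b; rewrite ger0_norm ?normal_pdf_ge0// normal_pdf_ub// gt_eqF.
Qed.

Lemma slice_integral_linear (f g : R -> R) (a c r t : R) :
  (forall k, (P k).-integrable setT (fun b => (f b)%:E)) ->
  (forall k, (P k).-integrable setT (fun b => (g b)%:E)) ->
  slice_integral P (fun _ b => (f b)%:E) = r%:E ->
  slice_integral P (fun _ b => (g b)%:E) = t%:E ->
  (forall k, (P k).-integrable setT (fun b => (a * f b + c * g b)%:E)) /\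
  slice_integral P (fun _ b => (a * f b + c * g b)%:E) = (a * r + c * t)%:E.
Proof.
move=> fi gi fr gt; split.
  move=> k; under eq_fun do rewrite EFinD !EFinM.
  by apply: integrableD => //; exact: integrableZl.
rewrite EFinD !EFinM -fr -gt /slice_integral.
rewrite !fin_num_sume_distrr; try by move=> i j _ _; apply: fin_num_adde_defl; exact: integrable_fin_num.
all: try by [].
rewrite -big_split/=; apply: eq_bigr => k _.
rewrite -!integralZl// -integralD//; first exact: integrableZl.
exact: integrableZl.
Qed.

(** Some component is not concentrated at a point. For the prior [delta_0] the posterior mean is
    constant. *)
Hypothesis Pnd : exists k, forall m, (0 < P k (~` [set m]))%E.

(* The likelihood ratio [N(y'; b, s^2) / N(y; b, s^2)] increases with [b]. *)
Lemma posterior_mean_increasing : {homo posterior_mean P s : y y' / y < y'}.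
Proof.
move=> y y' yy'; set m := posterior_mean P s y.
(* Since [b - m] integrates to zero against the posterior at [y], the integral of [g] is [normal_pdf
   m s y * marginal y' * (S y' - m)]. By [gE], [g] is a positive factor times [b - m] times
   [expR (c * (b - m)) - 1] with [c > 0], hence positive off [m]. *)
pose g b := normal_pdf m s y * ((b - m) * normal_pdf b s y')
  + (- normal_pdf m s y') * ((b - m) * normal_pdf b s y).
have gE b : g b = (b - m) * normal_pdf m s y' * normal_pdf b s y
    * (expR ((y' - y) / s ^+ 2 * (b - m)) - 1).
  rewrite /g !normal_pdf_expR//.
  set A := normal_peak s.
  rewrite (_ : - (y' - b) ^+ 2 / (s ^+ 2 *+ 2) =
    (- (y' - m) ^+ 2 / (s ^+ 2 *+ 2)) + (- (y - b) ^+ 2 / (s ^+ 2 *+ 2))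
    + (y' - y) / s ^+ 2 * (b - m) - (- (y - m) ^+ 2 / (s ^+ 2 *+ 2))).
    rewrite !expRD expRN; have := expR_gt0 (- (y - m) ^+ 2 / (s ^+ 2 *+ 2)).
    by move: (expR _) => e e0; field; rewrite gt_eqF.
  by rewrite -[_ *+ 2]mulr_natl; field; rewrite gt_eqF.
have d0 : 0 < (y' - y) / s ^+ 2 by rewrite divr_gt0 ?subr_gt0 ?exprn_gt0.
have g_gt0 b : b != m -> 0 < g b.
  move=> bm; rewrite gE.
  have p1 := normal_pdf_gt0 y' m s0; have p2 := normal_pdf_gt0 y b s0.
  have [bm'|bm'|/eqP] := ltgtP b m; last by rewrite (negbTE bm).
    rewrite nmulr_rgt0 ?pmulr_llt0 ?subr_lt0// -expR0 ltr_expR.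
    by rewrite pmulr_rlt0// subr_lt0.
  rewrite !mulr_gt0 ?subr_gt0// -expR0 ltr_expR.
  by rewrite mulr_gt0// subr_gt0.
have g_ge0 b : 0 <= g b.
  by have [->|/g_gt0/ltW//] := eqVneq b m; rewrite /g subrr !mul0r !mulr0 addr0.
have cI z : (forall k, (P k).-integrable setT (fun b => ((b - m) * normal_pdf b s z)%:E)) /\
    slice_integral P (fun _ b => ((b - m) * normal_pdf b s z)%:E) =
      (unnormalized_mean P s z - m * marginal P s z)%:E.
  have [i1 i2] := slice_integral_linear 1 (- m)
    (fun k => integrable_mul_normal_pdf P1 s0 k z)
    (fun k => integrable_normal_pdf_mean P1 s0 k z)
    (unnormalized_meanE P1 s0 z) (marginalE P1 s0 z).
  rewrite (_ : unnormalized_mean P s z - _ =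
    1 * unnormalized_mean P s z + - m * marginal P s z); last by ring.
  rewrite -i2.
  have E b : (b - m) * normal_pdf b s z =
    1 * (b * normal_pdf b s z) + - m * normal_pdf b s z by ring.
  split; first by move=> k; under eq_fun do rewrite E; exact: i1.
  by apply: eq_bigr => k _; apply: eq_integral => b _; rewrite E.
have [i1 e1] := cI y'; have [i2 e2] := cI y.
have [i3 e3] := slice_integral_linear (normal_pdf m s y) (- normal_pdf m s y') i1 i2 e1 e2.
have Z0 := marginal_gt0 P1 s0 y; have Z0' := marginal_gt0 P1 s0 y'.
have my : unnormalized_mean P s y - m * marginal P s y = 0.
  by rewrite /m /posterior_mean divfK ?subrr// gt_eqF.
rewrite my mulr0 addr0 in e3.
suff : 0 < normal_pdf m s y * (unnormalized_mean P s y' - m * marginal P s y').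
  rewrite pmulr_rgt0 ?normal_pdf_gt0// subr_gt0 => H.
  by rewrite /posterior_mean ltr_pdivlMr.
rewrite -lte_fin -e3 /slice_integral; have [k Pk] := Pnd.
rewrite (bigD1 k)//=.
have pk : (0 < \int[P k]_b (g b)%:E)%E.
  apply: (@integral_gt0 _ _ _ _ _ (~` [set m])) => //.
  - by apply/measurable_EFinP; exact: measurable_int (i3 k).
  - by move=> b /eqP; exact: g_gt0.
  - exact: measurableC.
apply: (lt_le_trans pk); rewrite leeDl//.
by apply: sume_ge0 => i _; apply: integral_ge0 => b _; rewrite lee_fin; exact: g_ge0.
Qed.

End posterior_mean_regularity.

(** * The evidence lower bound *)

Section slice_integral_step.
Local Open Scope ereal_scope.
Context (R : realType) (K : nat).
Variables (q : 'I_K.+1 -> {measure set R -> \bar R}) (m : R).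
Hypotheses (q1 : is_dist q)
  (qi : forall k, (q k).-integrable setT (fun x => x%:E))
  (qm : dmean (fun k => q k) = m%:E).

(** [C] stands for the cost of the coordinates already integrated, which may be [+oo]; then both
    sides are [+oo]. *)
Lemma slice_integral_addl_affine_square (C : \bar R) (L : 'I_K.+1 -> R -> R) (a b c : R) :
  -oo < C -> (0 <= c)%R -> (forall k, qintegrable (q k) (fun x => (L k x)%:E)) ->
  slice_integral q (fun k x => C + (a + b * (x - m) + (c * (x - m) ^+ 2 + L k x))%:E) =
  C + (a%:E + (c%:E * dvar (fun k => q k) m + slice_integral q (fun k x => (L k x)%:E))).
Proof.
move=> C0 c0 Li.
have Lgt := slice_integral_gtNy Li.
have V0 : 0 <= c%:E * dvar (fun k => q k) m by rewrite mule_ge0 ?dvar_ge0.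
case: C C0 => [r _|_|//].
  rewrite addeA -EFinD; have [<- _] := slice_integral_affine_square q1 qi qm (r + a) b c0 Li.
  by apply: eq_bigr => k _; apply: eq_integral => x _; rewrite -EFinD !addrA.
rewrite addye; last first.
  by rewrite !adde_eq_ninfty/= negb_or -!ltNye Lgt (lt_le_trans ltNy0 V0).
by rewrite -[RHS](slice_integral_cst q1).
Qed.

End slice_integral_step.

Section iterated_integral.
Local Open Scope ereal_scope.
Context (R : realType) (K : nat).
Variable Q : nat -> 'I_K.+1 -> {measure set R -> \bar R}.
Implicit Types phi psi : (nat -> R) -> (nat -> 'I_K.+1) -> \bar R.

Lemma iint_ge0 phi : (forall b g, 0 <= phi b g) ->
  forall m b g, 0 <= iint (fun j k => Q j k) phi m b g.
Proof.
move=> phi0; elim=> [|m IH] b g //=.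
by apply: sume_ge0 => k _; apply: integral_ge0.
Qed.

Lemma le_iint phi psi : (forall b g, 0 <= phi b g) -> (forall b g, phi b g <= psi b g) ->
  forall m b g, iint (fun j k => Q j k) phi m b g <= iint (fun j k => Q j k) psi m b g.
Proof.
move=> phi0 le m.
have psi0 b g : 0 <= psi b g by exact: le_trans (le b g).
elim: m => [|m IH] b g //=; apply: lee_sum => k _.
by apply: (@nonmeasurable_ge0_le_integral _ _ _ _ _ _ set0) => // x; exact: iint_ge0.
Qed.

Lemma iint_cst (C : \bar R) : (forall j, is_dist (Q j)) -> -oo < C ->
  forall m b g, iint (fun j k => Q j k) (fun _ _ => C) m b g = C.
Proof.
move=> Q1 C0; elim=> [|m IH] b g //=.
under eq_bigr do under eq_integral do rewrite IH.
exact: slice_integral_cst.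
Qed.

(** Positivity is carried through the iteration by a lower bound of fixed shape, which avoids
    measurability of the inner integrals: each integration removes one coordinate from the Gaussian
    and multiplies the constant by a positive number. *)
Lemma iint_gauss_gt0 p (A a : R) phi : (forall j, is_dist (Q j)) -> (0 <= a)%R ->
  (forall b g, (expR (A - a * \sum_(0 <= j < p) b j ^+ 2))%:E <= phi b g) ->
  forall b g, 0 < iint (fun j k => Q j k) phi p b g.
Proof.
move=> Q1 a0 le.
suff H m : (m <= p)%N -> exists2 C : R, (0 < C)%R & forall b g,
    (C * expR (- (a * \sum_(m <= j < p) b j ^+ 2)))%:E <=
    iint (fun j k => Q j k) phi m b g.
  move=> b g; have [C C0 /(_ b g)] := H p (leqnn p).
  by apply: lt_le_trans; rewrite lte_fin mulr_gt0// expR_gt0.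
have phi0 b g : 0 <= phi b g.
  by apply: le_trans (le b g); rewrite lee_fin expR_ge0.
elim: m => [_|m IH mp].
  by exists (expR A) => [|b g]; [exact: expR_gt0|rewrite -expRD; exact: le].
have [C C0 HC] := IH (ltnW mp).
have me : measurable_fun setT (fun x : R => expR (- (a * x ^+ 2))).
  apply: measurableT_comp => //; apply: measurableT_comp => //.
  by apply: measurable_funM => //; exact: measurable_funX.
have ei k : (Q m k).-integrable setT (fun x => (expR (- (a * x ^+ 2)))%:E).
  apply: (@bounded_integrable _ _ _ _ _ 1%R) => //; first exact: slice_mass_lty.
  move=> x; rewrite ger0_norm ?expR_ge0// -expR0 ler_expR oppr_le0.
  by rewrite mulr_ge0// sqr_ge0.
pose e0 := fine (slice_integral (Q m) (fun _ x => (expR (- (a * x ^+ 2)))%:E)).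
have e0E : slice_integral (Q m) (fun _ x => (expR (- (a * x ^+ 2)))%:E) = e0%:E.
  by rewrite fineK//; apply: slice_fin_num.
have e00 : (0 < e0)%R.
  rewrite -lte_fin -e0E; have [k Pk] := slice_mass_gt0 (Q1 m).
  rewrite /slice_integral (bigD1 k)//=.
  have pk : 0 < \int[Q m k]_x (expR (- (a * x ^+ 2)))%:E.
    by apply: (@integral_gt0 _ _ _ _ _ setT) => // x *; rewrite ?expR_gt0 ?expR_ge0.
  apply: (lt_le_trans pk); rewrite leeDl//.
  by apply: sume_ge0 => i _; apply: integral_ge0 => x _; rewrite lee_fin expR_ge0.
exists (C * e0)%R => [|b g]; first exact: mulr_gt0.
rewrite /= mulrAC EFinM -e0E /slice_integral ge0_sume_distrr; last first.
  by move=> k _; apply: integral_ge0 => x _; rewrite lee_fin expR_ge0.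
have c0 : (0 <= C * expR (- (a * \sum_(m.+1 <= j < p) b j ^+ 2)))%R.
  by rewrite mulr_ge0 ?expR_ge0// ltW.
apply: lee_sum => k _; rewrite -ge0_integralZl_EFin//; last first.
  exact/measurable_EFinP.
apply: (@nonmeasurable_ge0_le_integral _ _ _ _ _ _ set0) => //.
- by move=> x; rewrite -EFinM lee_fin !mulr_ge0 ?expR_ge0// ltW.
- by move=> x; exact: iint_ge0.
move=> x _; apply: le_trans (HC _ _); rewrite -EFinM lee_fin.
rewrite -mulrA -expRD (big_ltn mp).
have -> : (\sum_(m.+1 <= j < p) upd b m x j ^+ 2 = \sum_(m.+1 <= j < p) b j ^+ 2)%R.
  by apply: eq_big_nat => j /andP[mj _]; rewrite /upd gtn_eqF.
by rewrite /upd eqxx mulrDr opprD addrC.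
Qed.

End iterated_integral.

(** A crude Cauchy-Schwarz inequality, from [(u + v)^2 <= 2 u^2 + 2 v^2] at each term; only the
    existence of some constant matters. *)
Lemma sqr_sum_le (R : realType) (I : Type) (l : seq I) (c : I -> R) :
  exists2 a : R, 0 <= a &
  forall t : I -> R, (\sum_(j <- l) c j * t j) ^+ 2 <= a * \sum_(j <- l) t j ^+ 2.
Proof.
elim: l => [|j l [a a0 IH]].
  by exists 0 => // t; rewrite big_nil expr0n/= mul0r.
exists (2 * c j ^+ 2 + 2 * a) => [|t].
  by rewrite addr_ge0// mulr_ge0// sqr_ge0.
rewrite !big_cons; have := IH t.
set S := \sum_(_ <- _) _; set T := \sum_(_ <- _) _ => ST.
have T0 : 0 <= T by apply: sumr_ge0 => i _; exact: sqr_ge0.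
have h1 := sqr_ge0 (c j * t j - S).
have h2 : 0 <= c j ^+ 2 * T by rewrite mulr_ge0// sqr_ge0.
have h3 : 0 <= a * t j ^+ 2 by rewrite mulr_ge0// sqr_ge0.
have -> : (2 * c j ^+ 2 + 2 * a) * (t j ^+ 2 + T) =
  (c j * t j + S) ^+ 2 + ((c j * t j - S) ^+ 2 + 2 * (c j ^+ 2 * T)
  + 2 * (a * t j ^+ 2) + 2 * (a * T - S ^+ 2)) by ring.
by rewrite lerDl; lra.
Qed.

Lemma ln_prod (R : realType) (I : finType) (F : I -> R) :
  (forall i, 0 < F i) -> ln (\prod_i F i) = \sum_i ln (F i).
Proof.
move=> F0; suff [] : 0 < \prod_i F i /\ ln (\prod_i F i) = \sum_i ln (F i) by [].
elim: (index_enum I) => [|i l [IH0 IH]]; first by rewrite !big_nil ln1.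
by rewrite !big_cons mulr_gt0// (@lnM R (F i)) ?posrE// IH.
Qed.

Section evidence.
Context (R : realType) (n p K : nat).
Variables (y : 'cV[R]_n) (X : 'M[R]_(n, p)) (sigma2 : R).
Hypothesis sigma2_gt0 : 0 < sigma2.
Variable P : 'I_K.+1 -> {measure set R -> \bar R}.
Hypothesis P1 : is_dist P.

Definition evidence : \bar R :=
  prodE p (fun _ k => P k) (fun b _ => (expR (loglik y X sigma2 b))%:E).

Lemma loglikE b : loglik y X sigma2 b =
  - (n%:R / 2) * ln (2 * pi * sigma2)
  - (\sum_(i < n) (y i 0 - \sum_(j < p) X i j * b j) ^+ 2) / (2 * sigma2).
Proof.
rewrite /loglik; congr (_ - _ / _); apply: eq_bigr => i _.
by rewrite !mxE; congr ((_ - _) ^+ 2); apply: eq_bigr => j _; rewrite !mxE.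
Qed.

Lemma loglik_le b : loglik y X sigma2 b <= - (n%:R / 2) * ln (2 * pi * sigma2).
Proof.
rewrite loglikE gerBl divr_ge0 ?mulr_ge0 ?(ltW sigma2_gt0)//.
by apply: sumr_ge0 => i _; exact: sqr_ge0.
Qed.

(** Supplies the Gaussian minorant required by [iint_gauss_gt0], through
    [(y_i - S)^2 <= 2 y_i^2 + 2 S^2]. *)
Lemma loglik_ge : exists A a : R, 0 <= a /\
  forall b : nat -> R, A - a * \sum_(0 <= j < p) b j ^+ 2 <= loglik y X sigma2 b.
Proof.
have /choice[a aP] i : exists a : R, 0 <= a /\ forall t : 'I_p -> R,
    (\sum_(j < p) X i j * t j) ^+ 2 <= a * \sum_(j < p) t j ^+ 2.
  by have [a] := sqr_sum_le (index_enum 'I_p) (X i); exists a.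
exists (- (n%:R / 2) * ln (2 * pi * sigma2)
  - (\sum_(i < n) 2 * y i 0 ^+ 2) / (2 * sigma2)).
exists ((\sum_(i < n) 2 * a i) / (2 * sigma2)); split.
  rewrite divr_ge0 ?mulr_ge0 ?(ltW sigma2_gt0)//.
  by apply: sumr_ge0 => i _; rewrite mulr_ge0//; have [] := aP i.
move=> b; rewrite loglikE -addrA lerD2l mulrAC -opprD lerN2 -mulrDl.
rewrite ler_wpM2r ?invr_ge0 ?mulr_ge0 ?(ltW sigma2_gt0)//.
rewrite big_mkord mulr_suml -big_split/=; apply: ler_sum => i _.
have [_ /(_ (fun j => b j))] := aP i; set S := \sum_(j < p) X i j * b j.
set T := \sum_(j < p) _ => ST.
have h := sqr_ge0 (y i 0 + S).
rewrite (_ : 2 * y i 0 ^+ 2 + 2 * a i * T = (y i 0 - S) ^+ 2 +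
  ((y i 0 + S) ^+ 2 + 2 * (a i * T - S ^+ 2))); last by ring.
by rewrite lerDl; lra.
Qed.

(** Makes the log evidence a real number, so that its two occurrences in the ELBO cancel. *)
Lemma evidence_pos_fin : exists2 z : R, 0 < z & evidence = z%:E.
Proof.
have [A [a [a0 H]]] := loglik_ge.
have lo : (0 < evidence)%E.
  apply: (@iint_gauss_gt0 _ _ (fun _ => P) p A a) => // b g.
  by rewrite lee_fin ler_expR.
have hi : (evidence <= (expR (- (n%:R / 2) * ln (2 * pi * sigma2)))%:E)%E.
  rewrite -[leRHS](@iint_cst _ _ (fun _ => P) _ (fun _ => P1) (ltNyr _) p (fun _ => 0) (fun _ => ord0)).
  apply: le_iint => b g; first by rewrite lee_fin expR_ge0.
  by rewrite lee_fin ler_expR loglik_le.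
move: lo hi; case: evidence => [z z0 _| |]//; by exists z.
Qed.

Section elbo.
Local Open Scope ereal_scope.
Variables (q : 'I_p -> 'I_K.+1 -> {measure set R -> \bar R}) (m : 'cV[R]_p).
Hypotheses (q1 : forall j, is_dist (q j))
  (qi : forall j k, (q j k).-integrable setT (fun x => x%:E))
  (qm : forall j, dmean (fun k => q j k) = (m j ord0)%:E)
  (qP : forall j, abs_cont (fun k => q j k) (fun k => P k)).
Hypothesis X1 : forall j : 'I_p, (\sum_(i < n) X i j ^+ 2 = 1)%R.
Variable z : R.
Hypothesis z0 : (0 < z)%R.

Let f j := dens (fun k => q j k) (fun k => P k).
Let phi (b : nat -> R) (g : nat -> 'I_K.+1) := lne ((\prod_(j < p) f j (g j) (b j)) * z%:E
  * ((expR (loglik y X sigma2 b))^-1)%:E).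

(* The state of the iterated integral once the coordinates below [l] have been
   integrated out: their values are replaced by the means. *)
Let center l (b : nat -> R) (j : 'I_p) : R := if (j < l)%N then m j ord0 else b j.
Let rss l (b : nat -> R) : R := (\sum_(i < n) (y i 0 - \sum_(j < p) X i j * center l b j) ^+ 2)%R.
Let cost l : \bar R := \sum_(j < p | (j < l)%N)
  ((2 * sigma2)^-1%:E * dvar (fun k => q j k) (m j ord0)
   + KL (fun k => q j k) (fun k => P k)).
Let log_dens l (b : nat -> R) (g : nat -> 'I_K.+1) : R :=
  (\sum_(j < p | (l <= j)%N) ln (fine (f j (g j) (b j))))%R.
(** True outside the null sets of [slice_pos_fin_off_null]; it lets the logarithm of the product
    split into real logarithms. *)
Let regular l (b : nat -> R) (g : nat -> 'I_K.+1) := forall j : 'I_p, (l <= j)%N ->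
  (0 < fine (f j (g j) (b j)))%R /\ f j (g j) (b j) = (fine (f j (g j) (b j)))%:E.

Lemma cost_term_gtNy j : -oo < (2 * sigma2)^-1%:E * dvar (fun k => q j k) (m j ord0)
   + KL (fun k => q j k) (fun k => P k).
Proof.
have V0 : 0 <= (2 * sigma2)^-1%:E * dvar (fun k => q j k) (m j ord0).
  by rewrite mule_ge0 ?dvar_ge0// lee_fin invr_ge0 mulr_ge0// ltW.
by rewrite ltNye adde_eq_ninfty negb_or -!ltNye (KL_gtNy (q1 j) P1) (lt_le_trans ltNy0 V0).
Qed.

Lemma cost_gtNy l : -oo < cost l.
Proof.
rewrite ltNye; apply/negP => /eqP /esum_eqNyP [j [_ _ jE]].
by have := cost_term_gtNy j; rewrite jE.
Qed.

(** Expansion of the residual around the mean of coordinate [j]. The coefficient of the square is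
    the squared norm of column [j], equal to 1, and the linear term will integrate to zero. *)
Lemma rssS (j : 'I_p) b x : rss j (upd b j x) =
  (rss j.+1 b - (2 * \sum_(i < n) (y i 0 - \sum_(j0 < p) X i j0 * center j.+1 b j0) * X i j) * (x - m j ord0)
   + (x - m j ord0) ^+ 2)%R.
Proof.
rewrite /rss.
have E i : (y i 0 - \sum_(j0 < p) X i j0 * center j (upd b j x) j0 =
    y i 0 - \sum_(j0 < p) X i j0 * center j.+1 b j0 - X i j * (x - m j ord0))%R.
  rewrite (bigD1 j)//= [in RHS](bigD1 j)//= /center ltnn ltnSn /upd eqxx.
  set S1 := (\sum_(_ < p | _) _)%R; set S2 := (\sum_(_ < p | _) _)%R.
  suff -> : S1 = S2 by ring.
  apply: eq_bigr => i0 i0j; congr (_ * _)%R.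
  rewrite ltnS [in RHS]leq_eqVlt.
  have -> : (nat_of_ord i0 == j) = false by apply/negbTE.
  by [].
under eq_bigr do rewrite E.
transitivity (\sum_(i < n) ((y i 0 - \sum_(j0 < p) X i j0 * center j.+1 b j0) ^+ 2
    - 2 * ((y i 0 - \sum_(j0 < p) X i j0 * center j.+1 b j0) * X i j) * (x - m j ord0)
    + X i j ^+ 2 * (x - m j ord0) ^+ 2))%R.
  by apply: eq_bigr => i _; ring.
by rewrite big_split/= sumrB -!mulr_suml -mulr_sumr X1 mul1r.
Qed.

Lemma iint_elbo l : (l <= p)%N -> forall b g, regular l b g ->
  iint (ext (fun j k => q j k)) phi l b g =
  cost l + (ln z + n%:R / 2 * ln (2 * pi * sigma2) + log_dens l b g
            + rss l b / (2 * sigma2))%:E.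
Proof.
elim: l => [_|l IH lp] b g reg.
  rewrite /cost big_pred0// add0e /= /phi.
  have -> : \prod_(j < p) f j (g j) (b j) = (\prod_(j < p) fine (f j (g j) (b j)))%:E.
    by rewrite -prodEFin; apply: eq_bigr => j _; have [] := reg j isT.
  have f0 : (0 < \prod_(j < p) fine (f j (g j) (b j)))%R.
    by apply: prodr_gt0 => j _; have [] := reg j isT.
  have e0 : (0 < (expR (loglik y X sigma2 b))^-1)%R by rewrite invr_gt0 expR_gt0.
  rewrite -!EFinM lne_EFin ?mulr_gt0//; congr EFin.
  rewrite ln_div ?posrE ?mulr_gt0 ?expR_gt0// expRK.
  rewrite (@lnM R _ z) ?posrE//.
  have -> : ln (\prod_(j < p) fine (f j (g j) (b j))) = log_dens 0 b g.
    rewrite /log_dens ln_prod// => i; by have [] := reg i isT.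
  rewrite loglikE /rss /center /=; ring.
pose j := Ordinal lp.
have extE k : ext (fun j k => q j k) l k = q j k.
  by rewrite /ext insubT.
rewrite /=; under eq_bigr do rewrite extE.
have log_densS x k : log_dens l (upd b l x) (upd g l k) =
    (ln (fine (f j k x)) + log_dens l.+1 b g)%R.
  rewrite /log_dens (bigD1 j)//=; congr (_ + _)%R.
    by rewrite /upd eqxx.
  apply: eq_big => [i|i /andP[li ij]].
    by rewrite ltn_neqAle eq_sym andbC.
  have il : (nat_of_ord i == l) = false by apply/negbTE.
  by rewrite /upd il.
(* Almost everywhere in the coordinate [x], the induction hypothesis applies, and its value is
   sorted into constant, linear, quadratic and logarithmic parts in [x]. *)
transitivity (slice_integral (q j) (fun k x => cost l +
  ((ln z + n%:R / 2 * ln (2 * pi * sigma2) + log_dens l.+1 b g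
            + rss l.+1 b / (2 * sigma2))
   + (- ((2 * sigma2)^-1 * (2 * \sum_(i < n) (y i 0 - \sum_(j0 < p) X i j0 * center l.+1 b j0) * X i j))) * (x - m j ord0)
   + ((2 * sigma2)^-1 * (x - m j ord0) ^+ 2 + ln (fine (f j k x))))%:E)).
  apply: eq_slice_integral => k.
  have [N [mN N0 fN]] := slice_pos_fin_off_null (q1 j) (densP (qP j)) k.
  exists N; split => // x /fN [fx0 fxE].
  rewrite IH//; last 2 first.
  - exact: ltnW.
  - move=> i li; have [il|il] := eqVneq (nat_of_ord i) l.
      have ij : i = j by exact: val_inj.
      by rewrite /upd il eqxx ij.
    rewrite /upd (negbTE il); apply: reg.
    by rewrite ltn_neqAle eq_sym il.
  congr (_ + EFin _); rewrite log_densS (rssS j).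
  by field; rewrite gt_eqF.
have c0 : (0 <= (2 * sigma2)^-1)%R by rewrite invr_ge0 mulr_ge0// ltW.
have Lq k := slice_qintegrable_ln (q1 j) P1 (densP (qP j)) k.
rewrite (slice_integral_addl_affine_square (q1 j) (qi j) (qm j) _ _ (cost_gtNy l) c0 Lq).
(* The integrated square and log density are the new summand of [cost]. *)
rewrite -(KL_ln (q1 j) (qP j)) /cost [in RHS](bigD1 j)//=.
rewrite addeCA [LHS]addeC; congr (_ + _); rewrite addeC; congr (_ + _).
by apply: eq_bigl => i; rewrite ltnS ltn_neqAle andbC.
Qed.

Lemma prodE_elbo :
  prodE p (ext (fun j k => q j k)) (fun b g =>
    lne ((\prod_(j < p) dens (fun k => q j k) (fun k => P k) (g j) (b j)) * z%:E
         * ((expR (loglik y X sigma2 b))^-1)%:E)) =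
  \sum_(j < p) ((2 * sigma2)^-1%:E * dvar (fun k => q j k) (m j ord0)
                + KL (fun k => q j k) (fun k => P k))
  + (ln z + n%:R / 2 * ln (2 * pi * sigma2)
     + (\sum_(i < n) ((y - X *m m) i ord0) ^+ 2) / (2 * sigma2))%:E.
Proof.
rewrite /prodE iint_elbo//; last by move=> j /=; rewrite leqNgt ltn_ord.
congr (_ + EFin _).
  by apply: eq_bigl => j; rewrite ltn_ord.
rewrite /log_dens big_pred0 ?addr0; last by move=> j; rewrite leqNgt ltn_ord.
congr (_ + _ / _)%R; apply: eq_bigr => i _.
by rewrite !mxE; congr ((_ - _) ^+ 2)%R; apply: eq_bigr => j _; rewrite /center ltn_ord.
Qed.

End elbo.
End evidence.

(** * Infima over independent factors and the formula for [h] *)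

Lemma ereal_inf_sum (R : realType) (p : nat) (T : Type) (D : 'I_p -> set T)
    (F : 'I_p -> T -> \bar R) :
  (forall j, -oo < ereal_inf [set F j t | t in D j])%E ->
  (ereal_inf [set \sum_(j < p) F j (t j) | t in [set t : 'I_p -> T | forall j, D j (t j)]] =
   \sum_(j < p) ereal_inf [set F j t | t in D j])%E.
Proof.
move=> gtNy; apply/eqP; rewrite eq_le; apply/andP; split; last first.
  apply: le_ereal_inf_tmp => _ [t Dt <-]; apply: lee_sum => j _.
  by apply: ereal_inf_lbound; exists (t j).
(* If one infimum is [+oo], so is the sum, as no term is [-oo]. Otherwise near-minimizers are chosen
   for each index. *)
have [[j jy]|/forallNP fy] :=
    pselect (exists j, ereal_inf [set F j t | t in D j] = +oo%E).
  suff -> : (\sum_(j < p) ereal_inf [set F j t | t in D j] = +oo)%E by rewrite leey.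
  rewrite (bigD1 j)//= jy addye//; apply/negP => /eqP /esum_eqNyP [i [_ _ iE]].
  by have := gtNy i; rewrite iE.
have fin j : ereal_inf [set F j t | t in D j] \is a fin_num.
  rewrite fin_numE -ltNye gtNy/=; exact/eqP.
apply/lee_addgt0Pr => e e0.
(* Dividing by [p.+1] rather than [p] keeps this valid for [p = 0]. *)
have e1 : 0 < e / p.+1%:R by rewrite divr_gt0.
have /choice[t tP] j : exists t, D j t /\
    (F j t <= ereal_inf [set F j t | t in D j] + (e / p.+1%:R)%:E)%E.
  by have [_ [t Dt <-] /ltW le] := lb_ereal_inf_adherent e1 (fin j); exists t.
apply: (@le_trans _ _ (\sum_(j < p) F j (t j))%E).
  by apply: ereal_inf_lbound; exists t => // j; have [] := tP j.
apply: (@le_trans _ _ (\sum_(j < p) (ereal_inf [set F j t | t in D j] + (e / p.+1%:R)%:E))%E).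
  by apply: lee_sum => j _; have [] := tP j.
rewrite big_split/= leeD2l// sumEFin lee_fin sumr_const card_ord -[_ *+ p]mulr_natr -mulrA.
by rewrite ler_piMr ?(ltW e0)// mulrC ler_pdivrMr// mul1r ler_nat.
Qed.

Lemma ereal_inf_addl (R : realType) (c : R) (A : set (\bar R)) :
  (ereal_inf [set c%:E + x | x in A] = c%:E + ereal_inf A)%E.
Proof.
apply/eqP; rewrite eq_le; apply/andP; split; last first.
  apply: le_ereal_inf_tmp => _ [x Ax <-]; rewrite leeD2l//.
  exact: ereal_inf_lbound.
rewrite -leeBlDl//; apply: le_ereal_inf_tmp => x Ax; rewrite leeBlDl//.
by apply: ereal_inf_lbound; exists x.
Qed.

Lemma gtNy_adde_def (R : realDomainType) (a b : \bar R) :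
  (-oo < a -> -oo < b -> a +? b)%E.
Proof. by case: a b => [a| |] [b| |]. Qed.

Lemma sume_gtNy (R : realDomainType) (I : finType) (D : pred I) (F : I -> \bar R) :
  (forall i, -oo < F i)%E -> (-oo < \sum_(i | D i) F i)%E.
Proof.
move=> F0; rewrite ltNye; apply/negP => /eqP /esum_eqNyP [i [_ _ iE]].
by have := F0 i; rewrite iE.
Qed.

Section h_function.
Context (R : realType) (n p K : nat).
Variables (y : 'cV[R]_n) (X : 'M[R]_(n, p)) (w s2 : 'I_K.+1 -> R) (sigma2 : R).
Hypothesis sigma2_gt0 : 0 < sigma2.
Hypothesis X1 : forall j : 'I_p, \sum_(i < n) X i j ^+ 2 = 1.
Variable P : 'I_K.+1 -> {measure set R -> \bar R}.
Hypotheses (P1 : is_dist P)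
  (PE : prior_slice w (gsig_sd s2 sigma2) = (fun k => P k)).

Let s := Num.sqrt sigma2.

Let s_gt0 : 0 < s. Proof. by rewrite sqrtr_gt0. Qed.

Let sE : s ^+ 2 = sigma2. Proof. by rewrite sqr_sqrtr// ltW. Qed.

(** Each coordinate contributes [ln (2 * pi * sigma2) / 2]; the [p] copies account for [n - p] in
    the final constant. *)
Lemma scaled_objective q m : is_dist q -> ((sigma2^-1)%:E * objective P s q m =
  (ln (2 * pi * sigma2) / 2)%:E + ((2 * sigma2)^-1%:E * dvar (fun k => q k) m
    + KL (fun k => q k) (fun k => P k)))%E.
Proof.
move=> q1; rewrite /objective sE.
have := KL_gtNy q1 P1; have := dvar_ge0 q m.
move: (KL _ _) (dvar _ _) => L V.
have i0 : 0 < sigma2^-1 by rewrite invr_gt0.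
have sy : (sigma2%:E * +oo = +oo :> \bar R)%E by rewrite gt0_muley.
have iy : (sigma2^-1%:E * +oo = +oo :> \bar R)%E by rewrite gt0_muley.
have hy : ((1 / 2)%:E * +oo = +oo :> \bar R)%E by rewrite gt0_muley// lte_fin; lra.
have vy : ((2 * sigma2)^-1%:E * +oo = +oo :> \bar R)%E.
  by rewrite gt0_muley// lte_fin invr_gt0 mulr_gt0.
case: V => [v| |] //; case: L => [l| |] // _ _;
  rewrite ?vy ?sy ?hy ?addey ?addye ?sy ?iy ?addey//.
by rewrite /=; congr EFin; field; rewrite gt_eqF.
Qed.

Lemma neg_ELBO (q : 'I_p -> 'I_K.+1 -> {measure set R -> \bar R}) (m : 'cV[R]_p) :
  (forall j, is_dist (q j)) ->
  (forall j k, (q j k).-integrable setT (fun x => x%:E)) ->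
  (forall j, dmean (fun k => q j k) = (m j ord0)%:E) ->
  (- ELBO y X w s2 sigma2 (fun j k => q j k) =
   ((2 * sigma2)^-1 * \sum_(i < n) ((y - X *m m) i ord0) ^+ 2)%:E
   + (sigma2^-1)%:E * \sum_(j < p) objective P s (q j) (m j ord0)
   + ((n%:R - p%:R) / 2 * ln (2 * pi * sigma2))%:E)%E.
Proof.
move=> q1 qi qm.
(* The dual bound at observation [0]; any observation would do. *)
have obj_gtNy j : (-oo < objective P s (q j) (m j ord0))%E.
  by apply: lt_le_trans (objective_ge P1 s_gt0 0 (q1 j) (qi j) (qm j)); rewrite ltNyr.
have -> : ((sigma2^-1)%:E * \sum_(j < p) objective P s (q j) (m j ord0) =
  (p%:R * (ln (2 * pi * sigma2) / 2))%:E + \sum_(j < p)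
   ((2 * sigma2)^-1%:E * dvar (fun k => q j k) (m j ord0)
    + KL (fun k => q j k) (fun k => P k)))%E.
  rewrite fin_num_sume_distrr//; last first.
    by move=> i j _ _; exact: (gtNy_adde_def (obj_gtNy i) (obj_gtNy j)).
  under eq_bigr do rewrite scaled_objective//.
  by rewrite big_split/= sumEFin sumr_const card_ord (mulr_natl _ p).
have cNy := cost_term_gtNy sigma2_gt0 P1 m q1.
rewrite /ELBO PE.
have [qP|] := pselect (forall j, abs_cont (fun k => q j k) (fun k => P k)); last first.
  (* If one factor has no density, the ELBO is [-oo] and the divergence of that factor is [+oo], so
     both sides are [+oo]. *)
  move=> nqP; rewrite (is_left_pselectF nqP).
  have /existsNP[j nj] := nqP.
  have Kj : KL (fun k => q j k) (fun k => P k) = +oo%E.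
    by rewrite /KL (is_left_pselectF nj).
  rewrite (bigD1 j)//= Kj.
  have V0 : (0 <= (2 * sigma2)^-1%:E * dvar (fun k => q j k) (m j ord0))%E.
    by rewrite mule_ge0 ?dvar_ge0// lee_fin invr_ge0 mulr_ge0// ltW.
  rewrite (addey (x := ((2 * sigma2)^-1%:E * _)%E)); last by rewrite -ltNye (lt_le_trans _ V0).
  by rewrite addye ?addey// -ltNye sume_gtNy.
rewrite (is_left_pselectT qP).
have [z z0 zE] := evidence_pos_fin y X sigma2_gt0 P1.
rewrite -/(evidence y X sigma2 P) zE lne_EFin//.
rewrite (prodE_elbo y sigma2_gt0 P1 q1 qi qm qP X1 z0).
move: (sume_gtNy predT cNy); move: (\sum_(j < p) _)%E => C.
by case: C => [c _| |]//=; congr EFin; field; rewrite gt_eqF.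
Qed.

Lemma hfunE (m : 'cV[R]_p) : hfun y X w s2 sigma2 m =
  (((2 * sigma2)^-1 * \sum_(i < n) ((y - X *m m) i ord0) ^+ 2)%:E
   + (sigma2^-1)%:E * \sum_(j < p) rho w (gsig_sd s2 sigma2) s (m j ord0)
   + ((n%:R - p%:R) / 2 * ln (2 * pi * sigma2))%:E)%E.
Proof.
pose D j := [set q : 'I_K.+1 -> {measure set R -> \bar R} | [/\ is_dist q,
  forall k, (q k).-integrable setT (fun x => x%:E) &
  dmean (fun k => q k) = (m j ord0)%:E]].
have rhoD j : rho w (gsig_sd s2 sigma2) s (m j ord0) =
    ereal_inf [set objective P s q (m j ord0) | q in D j].
  rewrite (rhoE _ PE); congr ereal_inf; apply/seteqP; split.
    by move=> _ [q [? ? ? ->]]; exists q.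
  by move=> _ [q [? ? ?] <-]; exists q.
rewrite (eq_bigr _ (fun j _ => rhoD j)) -ereal_inf_sum; last first.
  move=> j; rewrite -rhoD; apply: lt_le_trans (rho_ge P1 s_gt0 PE 0 _).
  by rewrite ltNyr.
(* The affine map is moved inside the infimum, so that both sides become infima of sets to be
   compared. *)
rewrite -ereal_inf_pZl ?invr_gt0// addeC -ereal_inf_addl -ereal_inf_addl.
rewrite /hfun -ereal_infN; congr ereal_inf; apply/seteqP; split.
- move=> _ [_ [q [q1 qi qm ->]] <-]; rewrite (neg_ELBO q1 qi qm) addeC.
  eexists; last by [].
  eexists; last by [].
  eexists; last by [].
  by exists q => // j; split.
- move=> _ [_ [_ [_ [q Dq <-] <-] <-] <-].
  exists (ELBO y X w s2 sigma2 (fun j k => q j k)).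
    exists q; split => // j; by have [] := Dq j.
  rewrite (@neg_ELBO q m) 1?addeC//; move=> j; by have [] := Dq j.
Qed.

End h_function.

(** * The formula for [h], and the value and derivative of the penalty at the posterior mean *)

Unset Implicit Arguments.

Theorem theorem1 (R : realType) (n p K : nat)
  (y : 'cV[R]_n) (X : 'M[R]_(n, p))
  (s2 : 'I_K.+1 -> R) (w : 'I_K.+1 -> R) (sigma2 : R) :
  (forall j : 'I_p, \sum_(i < n) X i j ^+ 2 = 1) ->
  s2 ord0 = 0 ->
  (forall i j : 'I_K.+1, (i < j)%N -> s2 i < s2 j) ->
  (forall k, 0 <= w k) -> \sum_(k < K.+1) w k = 1 ->
  0 < sigma2 ->
  (forall bbar : 'cV[R]_p,
     hfun y X w s2 sigma2 bbar =
       (((2 * sigma2)^-1 * \sum_(i < n) ((y - X *m bbar) i ord0) ^+ 2)%:E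
        + (sigma2^-1)%:E
          * \sum_(j < p) rho w (gsig_sd s2 sigma2) (Num.sqrt sigma2) (bbar j ord0)
        + ((n%:R - p%:R) / 2 * ln (2 * pi * sigma2))%:E)%E)
  /\
  (forall y0 : R,
     let u := gsig_sd s2 sigma2 in
     let s := Num.sqrt sigma2 in
     let Sy := S_NM w u s y0 in
     rho w u s Sy = (- (sigma2%:E * ell_NM w u s y0) - ((y0 - Sy) ^+ 2 / 2)%:E)%E
     /\ (w ord0 < 1 ->
         is_derive Sy 1 (fun b => fine (rho w u s b)) (y0 - Sy))).
Proof.
move=> X1 s20 s2mono w0 w1 sigma2_gt0.
have [P PE] := ex_prior_measure (gsig_sd s2 sigma2) w0.
have Pk k : P k setT = (w k)%:E.
  by rewrite -(prior_slice_setT w (gsig_sd s2 sigma2)) PE.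
have P1 : is_dist P.
  by rewrite /is_dist; under eq_bigr do rewrite Pk; rewrite sumEFin w1.
split; first by move=> bbar; apply: (hfunE y sigma2_gt0 X1 P1 PE).
move=> y0 u s Sy.
have s0 : 0 < s by rewrite sqrtr_gt0.
have sE : s ^+ 2 = sigma2 by rewrite sqr_sqrtr// ltW.
have SE y' : S_NM w u s y' = posterior_mean P s y' by exact: S_NME.
have rhoS y' : rho w u s (posterior_mean P s y') =
    (dual_value P s y' (posterior_mean P s y'))%:E by exact: rho_posterior_mean.
have Z0 := marginal_gt0 P1 s0 y0.
split.
  rewrite /Sy SE rhoS /ell_NM (nm_marginalE P1 s0 PE) lne_EFin//.
  by rewrite /dual_value sE.
move=> w0lt1.
(* Some component other than the point mass at 0 has positive weight; its variance is positive
   because the grid increases strictly from 0. *)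
have [k wk] : exists k, (k != ord0) && (0 < w k).
  apply/existsP; apply: contraTT w0lt1 => /existsPn H.
  rewrite -leNgt -w1 (bigD1 ord0)//= big1 ?addr0// => k k0.
  have := H k; rewrite k0/= -leNgt => wk0.
  by apply/eqP; rewrite eq_le wk0 w0.
have /andP[k0 wk0] := wk.
have uk : u k != 0.
  have kpos : (@ord0 K < k)%N by rewrite lt0n.
  by rewrite gt_eqF// sqrtr_gt0 mulr_gt0// -s20 s2mono.
have Pnd : exists k, forall m, (0 < P k (~` [set m]))%E.
  exists k => m; rewrite [P k _](_ : _ = (w k)%:E) ?lte_fin//.
  by rewrite -(prior_slice_setC1 w m uk) PE.
rewrite /Sy SE.
apply: is_derive_chord_slopes.
- exact: continuous_posterior_mean.
- exact: posterior_mean_increasing.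
(* The bound for [y1] at [S y2] minus its equality case at [S y1]: the marginal terms cancel, and
   the difference of squares factors as [(S y2 - S y1) * (y1 - (S y2 + S y1) / 2)]. *)
move=> y1 y2.
have := rho_ge P1 s0 PE y1 (posterior_mean P s y2); rewrite !rhoS lee_fin /=.
set a := posterior_mean P s y1; set b := posterior_mean P s y2 => le_dual.
apply: le_trans (lerB le_dual (lexx _)).
by rewrite /dual_value le_eqVlt; apply/orP; left; apply/eqP; field.
Qed.
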